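(* Let $\varphi$ be an Orlicz function and $w$ a decreasing positive weight function on $I=(0,a)$, $0<a\le\infty$, such that $W(t)=\int_0^t w\,dm<\infty$ for all $t\in I$. Then for $f\in\mathcal M_{\varphi,w}$ we have $$\|f\|_{\mathcal M_{\varphi,w}}=\inf\{\|f\|_{\mathrm M_v}: v\prec w,\ v>0,\ v\text{ decreasing}\}=\inf\{\|g\|_{\mathrm M}: f\prec g\}=\|f^0\|_{\mathrm M},$$ $$\|f\|^0_{\mathcal M_{\varphi,w}}=\inf\{\|f\|^0_{\mathrm M_v}: v\prec w,\ v>0,\ v\text{ decreasing}\}=\inf\{\|g\|^0_{\mathrm M}: f\prec g\}=\|f^0\|^0_{\mathrm M},$$ where $\|\cdot\|_{\mathrm M},\|\cdot\|_{\mathrm M_v}$ are the Luxemburg gauges and $\|\cdot\|^0_{\mathrm M},\|\cdot\|^0_{\mathrm M_v}$ the Amemiya (Orlicz) gauges of $\mathrm M,\mathrm M_v$, and $f^0$ is the level function of $f$ with respect to $w$.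
   Context: $m$ is Lebesgue measure; functions are identified when equal a.e.; ''decreasing'' means non-increasing. $L^0(I)$ is the space of real Lebesgue measurable functions on $I$. $f^*$ is the decreasing rearrangement of $f\in L^0(I)$ with respect to $m$. $f\prec g$ means $\int_0^x f^*\,dm\le\int_0^x g^*\,dm$ for all $x\in I$. An Orlicz function is a convex $\varphi:[0,\infty)\to[0,\infty)$ with $\varphi(0)=0$ and $\varphi>0$ on $(0,\infty)$. For a positive decreasing weight $v$ on $I$ and $f\in L^0(I)$, $\mathrm M_v(f)=\int_I\varphi\left(\frac{f^*}{v}\right)v\,dm\in[0,\infty]$, and $\mathrm M=\mathrm M_w$. For a functional $\rho:L^0(I)\to[0,\infty]$ the Luxemburg gauge is $\|f\|_\rho=\inf\{\lambda>0:\rho(f/\lambda)\le1\}$ and the Amemiya (Orlicz) gauge is $\|f\|_\rho^0=\inf_{t>0}t(1+\rho(f/t))$ (values in $[0,\infty]$). $M_{L_\varphi,v}$ is the class of $f$ with $\mathrm M_v(\lambda f)<\infty$ for some $\lambda>0$. $Q_{L_\varphi,w}$ is the set of $f\in L^0(I)$ with $f\prec g$ for some $g\in M_{L_\varphi,w}$, and $P_{L_\varphi,w}$ is the union of the classes $M_{L_\varphi,v}$ over positive decreasing $v\prec w$. These two sets coincide, and $\mathcal M_{\varphi,w}:=Q_{L_\varphi,w}=P_{L_\varphi,w}$. It carries two norms, $\|\cdot\|_{\mathcal M_{\varphi,w}}$ and $\|\cdot\|^0_{\mathcal M_{\varphi,w}}$, corresponding to the Luxemburg and the Orlicz norm on $L_\varphi$: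 they are the common values $\|f\|_{\mathcal M_{\varphi,w}}=\|f\|_{Q_{L_\varphi,w}}=\|f\|_{P_{L_\varphi,w}}$, where $\|f\|_{Q_{L_\varphi,w}}=\inf\{\|g\|_{\mathrm M}: f\prec g\}$ and $\|f\|_{P_{L_\varphi,w}}=\inf\{\|f\|_{\mathrm M_v}:v\prec w,\ v>0,\ v\text{ decreasing}\}$ when $L_\varphi$ has the Luxemburg norm, and $\|f\|^0_{\mathcal M_{\varphi,w}}$ is given likewise with $\|\cdot\|^0_{\mathrm M},\|\cdot\|^0_{\mathrm M_v}$ when $L_\varphi$ has the Orlicz norm. (The equality of the $P$- and $Q$-expressions is part of what the theorem asserts.) Level function (Halperin). For $f\in L^0(I)$ with $f^*$ finite and integrable on the finite intervals $(0,t)$, $t\in I$, and $0\le\alpha<\beta<\infty$, $(\alpha,\beta)\subset I$, put $W(\alpha,\beta)=\int_\alpha^\beta w\,dm$, $F(\alpha,\beta)=\int_\alpha^\beta f^*\,dm$, $R(\alpha,\beta)=F(\alpha,\beta)/W(\alpha,\beta)$, and, if $a=\infty$, $R(\alpha,\infty)=\limsup_{t\to\infty}R(\alpha,t)$. An interval $(\alpha,\beta)\subset I$ ($\beta\le\infty$) is a level interval if $R(\alpha,\beta)>0$ and $R(\alpha,t)\le R(\alpha,\beta)$ for each $t\in(\alpha,\beta)$; it is a maximal level interval if not contained in a larger level interval. Maximal level intervals are pairwise disjoint, hence at most countably many. The level function is $f^0(t)=R(\alpha,\beta)w(t)$ if $t$ belongs to a maximal level interval $(\alpha,\beta)$, and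 $f^0(t)=f^*(t)$ otherwise. *)

(* Defs.v *)
From HB Require Import structures.
From mathcomp Require Import all_boot all_order all_algebra.
From mathcomp Require Import all_classical all_reals all_analysis.
Import Order.TTheory GRing.Theory Num.Theory.
Import numFieldNormedType.Exports.

Set Implicit Arguments.
Unset Strict Implicit.
Unset Printing Implicit Defensive.

Local Open Scope classical_set_scope.
Local Open Scope ring_scope.

(* Functions on I = (0, a) are represented by functions on the whole line of
   which only the values on I matter.  Rearrangements, modulars and gauges are
   defined for extended-real-valued functions, because f^* and the level
   function may take the value +oo; a real function f enters as EFin \o f. *)

Definition oint (R : realType) (x y : \bar R) : set R :=
  [set t | (x < t%:E < y)%E].

(* R with the sigma-algebra of Lebesgue measurable sets, the domain of
   completed_lebesgue_measure. *)
Definition lebesgueR (R : realType) :=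
  caratheodory_type (R := R) (mu_ext (wlength (R := R) idfun)).

Definition L0 (R : realType) (a : \bar R) (f : R -> R) : Prop :=
  measurable_fun (oint 0 a : set (lebesgueR R)) (f : lebesgueR R -> R).

Definition distr (R : realType) (a : \bar R) (f : R -> \bar R) (l : R) : \bar R :=
  completed_lebesgue_measure
    ([set x | oint 0 a x /\ (l%:E < `|f x|)%E] : set (lebesgueR R)).

Definition rearr (R : realType) (a : \bar R) (f : R -> \bar R) (t : R) : \bar R :=
  ereal_inf [set l%:E | l in [set l : R | 0 < l /\ (distr a f l <= t%:E)%E]].

Definition prec (R : realType) (a : \bar R) (f g : R -> \bar R) : Prop :=
  forall x : R, oint 0 a x ->
    (\int[lebesgue_measure]_(t in `]0%R, x[) rearr a f t
      <= \int[lebesgue_measure]_(t in `]0%R, x[) rearr a g t)%E.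

Definition orlicz_function (R : realType) (phi : R -> R) : Prop :=
  [/\ convex_function (`[0, +oo[%classic : set R) phi,
      phi 0 = 0 & forall u, 0 < u -> 0 < phi u].

Definition decreasing_weight (R : realType) (a : \bar R) (v : R -> R) : Prop :=
  {in oint 0 a, forall t, 0 < v t} /\ {in oint 0 a &, nonincreasing_fun v}.

(* er_map extends phi by phi(+oo) = +oo, the limit of phi at infinity. *)
Definition modular (R : realType) (a : \bar R) (phi v : R -> R)
    (f : R -> \bar R) : \bar R :=
  (\int[lebesgue_measure]_(t in oint 0 a)
     (er_map phi (rearr a f t / (v t)%:E) * (v t)%:E))%E.

Definition luxemburg (R : realType) (rho : (R -> \bar R) -> \bar R)
    (f : R -> \bar R) : \bar R :=
  ereal_inf [set l%:E | l in
    [set l : R | 0 < l /\ (rho (fun x => f x / l%:E) <= 1)%E]].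

Definition amemiya (R : realType) (rho : (R -> \bar R) -> \bar R)
    (f : R -> \bar R) : \bar R :=
  ereal_inf [set (t%:E * (1 + rho (fun x => f x / t%:E)))%E | t in
    [set t : R | 0 < t]].

Definition M_class (R : realType) (a : \bar R) (phi v : R -> R)
    (f : R -> R) : Prop :=
  L0 a f /\ exists2 l : R, 0 < l &
    (modular a phi v (EFin \o (fun x => l * f x)%R) < +oo)%E.

Definition Q_class (R : realType) (a : \bar R) (phi w : R -> R)
    (f : R -> R) : Prop :=
  L0 a f /\ exists2 g : R -> R,
    M_class a phi w g & prec a (EFin \o f) (EFin \o g).

(* gauge is either luxemburg or amemiya *)
Definition Q_norm (R : realType) (a : \bar R) (phi w : R -> R)
    (gauge : ((R -> \bar R) -> \bar R) -> (R -> \bar R) -> \bar R)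
    (f : R -> R) : \bar R :=
  ereal_inf [set gauge (modular a phi w) (EFin \o g) | g in
    [set g : R -> R | L0 a g /\ prec a (EFin \o f) (EFin \o g)]].

(* The space and its two norms are the common values of the Q-construction
   (f majorized by some g) and the P-construction (weights v majorized by w).
   The Q-construction is taken as the definition. *)
Definition calM (R : realType) (a : \bar R) (phi w : R -> R) :
  (R -> R) -> Prop := Q_class a phi w.

Definition calM_norm (R : realType) (a : \bar R) (phi w : R -> R) :
  (R -> R) -> \bar R := Q_norm a phi w (@luxemburg R).

Definition calM_norm0 (R : realType) (a : \bar R) (phi w : R -> R) :
  (R -> R) -> \bar R := Q_norm a phi w (@amemiya R).

Section level_function.
Variables (R : realType) (a : \bar R) (w f : R -> R).

Definition ratio (alpha beta : R) : \bar R :=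
  ((\int[lebesgue_measure]_(t in `]alpha, beta[) rearr a (EFin \o f) t)
    / (\int[lebesgue_measure]_(t in `]alpha, beta[) (w t)%:E))%E.

(* The branch b = -oo does not occur: right endpoints exceed alpha >= 0. *)
Definition eratio (alpha : R) (b : \bar R) : \bar R :=
  if b is beta%:E then ratio alpha beta
  else limf_esup (ratio alpha) (pinfty_nbhs R).

Definition level_interval (alpha : R) (b : \bar R) : Prop :=
  [/\ 0 <= alpha, (alpha%:E < b)%E, oint alpha%:E b `<=` oint 0 a,
      (0 < eratio alpha b)%E &
      forall t : R, oint alpha%:E b t -> (ratio alpha t <= eratio alpha b)%E].

Definition maximal_level_interval (alpha : R) (b : \bar R) : Prop :=
  level_interval alpha b /\
  forall (alpha' : R) (b' : \bar R), level_interval alpha' b' ->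
    oint alpha%:E b `<=` oint alpha'%:E b' -> alpha' = alpha /\ b' = b.

(* Maximal level intervals being disjoint, the interval chosen by cid is the
   only one containing t.  The definition is meaningful when f^* is finite and
   integrable on each (0, t), t in I, as it is for f in calM. *)
Definition level_fun (t : R) : \bar R :=
  match pselect (exists p : R * \bar R,
          maximal_level_interval p.1 p.2 /\ oint p.1%:E p.2 t) with
  | left ex => let p := projT1 (cid ex) in (eratio p.1 p.2 * (w t)%:E)%E
  | right _ => rearr a (EFin \o f) t
  end.

End level_function.

(* Main.v *)
(* Write F, W for the primitives of f^*, w and let sigma(t) be the slope at t,
   with respect to W, of the least W-concave majorant of F.  The maximal level
   intervals are the interiors of the sets where sigma takes a constant value
   c > 0, and f^0 = sigma w off a countable set.

   Lower bounds.  If f is majorized by g and the weight u by w, then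
     int (g^* - s u)_+ >= sup (F - s W) >= int (f^0 - s w)_+   for all s > 0,
   and since phi is a mixture of the functions z |-> (z - s)_+, the modular of f^0
   is at most int phi(g^* / u) u.  Both infima are therefore at least the gauge
   of f^0.

   Upper bounds.  The Q-infimum is attained at g = sigma w.  The P-infimum is
   attained at v = f^* / sigma on the level intervals and v = w elsewhere: then
   f^* / v = f^0 / w, and v and w have the same integral over each bounded level
   interval (int v <= int w over an unbounded one), on which f^0 / w is constant. *)
Require Import Defs.
From mathcomp Require Import all_boot all_order all_algebra.
From mathcomp Require Import all_classical all_reals all_analysis.
From mathcomp Require Import measurable_realfun.
From mathcomp Require Import ring lra.
Import Order.TTheory GRing.Theory Num.Theory.
Import numFieldNormedType.Exports.
Local Open Scope classical_set_scope.
Local Open Scope ring_scope.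

Set Implicit Arguments.
Unset Strict Implicit.
Unset Printing Implicit Defensive.

(** * Slopes of the least concave majorant *)

Section level_sets.
Variables (R : realType) (a : \bar R) (F W : R -> R).

(** The majorant itself is never built: every property of sigma is derived from comparisons of F - s
    W at two points. The first link of the lower bound is F(y) <= int_0^y g^* <= int (g^* - s u)_+ +
    s int_0^y u, whose last term is at most s W(y).

    Three obstacles shape the rest. On an unbounded I a supremum of F - s W need not be attained, so
    lateness of points has to stand in for a maximiser at +oo. The function sigma may take
    uncountably many values, but a plateau with interior contains a rational; integrals are
    therefore compared plateau by plateau on countably many plateaus and pointwise elsewhere.
    Finally f^* is only right-continuous, so f^0 may differ from sigma w at countably many points,
    and rearrangement has to be shown insensitive to this.

    The extremal g and v do not change when f is divided by a scalar, so the modulars can be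
    compared at all scales with the same g or v. Both gauges then follow from monotonicity alone. *)

Definition dom (y : R) : Prop := 0 <= y /\ (y%:E <= a)%E.

Definition excess (s y : R) : R := F y - s * W y.

(* The [s] for which [excess s] does not attain its supremum strictly before [t].
   Hence [slope] is the derivative with respect to [W] of the least [W]-concave
   majorant of [F], that is f^0 / w. *)
Definition late (t : R) : set R := [set s | 0 <= s /\
  forall x, 0 <= x <= t -> exists y, [/\ dom y, t <= y & excess s x <= excess s y]].

Definition slope (t : R) : R := sup (late t).

Definition is_argmax (s x : R) : Prop :=
  dom x /\ forall y, dom y -> excess s y <= excess s x.

Definition plateau (c : R) : set R := [set t | oint 0 a t /\ slope t = c].

(** [pair_FAB] is what membership in [calM] leaves on F; it keeps [slope] finite. The bounds extend
    to a finite end point a, where a maximum of [excess] may sit. *)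
Record primitive_pair (A B : R) : Prop := PrimitivePair {
  pair_F0 : F 0 = 0;
  pair_W0 : W 0 = 0;
  pair_Fc : continuous F;
  pair_Wc : continuous W;
  pair_Fle : forall x y : R, 0 <= x -> x <= y -> dom y -> F x <= F y;
  pair_Wlt : forall x y : R, 0 <= x -> x < y -> dom y -> W x < W y;
  pair_FAB : forall y, dom y -> F y <= A * W y + B }.

Variables (A B : R).
Hypothesis pairP : primitive_pair A B.
Let F0 := pair_F0 pairP.
Let W0 := pair_W0 pairP.
Let Fc := pair_Fc pairP.
Let Wc := pair_Wc pairP.
Let Fle := pair_Fle pairP.
Let Wlt := pair_Wlt pairP.
Let FAB := pair_FAB pairP.

Lemma dom_le x y : 0 <= x -> x <= y -> dom y -> dom x.
Proof. by move=> x0 xy [_ ya]; split=> //; apply: le_trans ya; rewrite lee_fin. Qed.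

Lemma oint_dom t : oint 0 a t -> dom t.
Proof. by case/andP; rewrite lte_fin => /ltW t0 /ltW. Qed.

Lemma oint_gt0 t : oint 0 a t -> 0 < t.
Proof. by case/andP; rewrite lte_fin. Qed.

Lemma oint_lt x y : 0 < x -> x <= y -> oint 0 a y -> oint 0 a x.
Proof.
move=> x0 xy /andP[_ ya]; apply/andP; rewrite lte_fin; split=> //.
by apply: le_lt_trans ya; rewrite lee_fin.
Qed.

Lemma dom_oint x y : 0 < x -> x < y -> dom y -> oint 0 a x.
Proof.
move=> x0 xy [_ ya]; apply/andP; rewrite lte_fin; split=> //.
by apply: lt_le_trans ya; rewrite lte_fin.
Qed.

Lemma Wle x y : 0 <= x -> x <= y -> dom y -> W x <= W y.
Proof. by move=> x0; rewrite le_eqVlt => /predU1P[->//|xy] /(Wlt x0 xy)/ltW. Qed.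

Lemma W_ge0 y : dom y -> 0 <= W y.
Proof. by move=> dy; rewrite -W0; apply: Wle => //; case: dy. Qed.

Lemma late0 t : dom t -> late t 0.
Proof.
move=> dt; split=> // x /andP[x0 xt]; exists t; split=> //.
by rewrite /excess !mul0r !subr0; exact: Fle.
Qed.

Lemma late_le t s s' : 0 <= s' -> s' <= s -> late t s -> late t s'.
Proof.
move=> s'0 s's [s0 H]; split=> // x /[dup] xt /H[y [dy ty xy]]; exists y; split=> //.
have /andP[x0 xt'] := xt.
have := Wle x0 (le_trans xt' ty) dy.
by move: xy; rewrite /excess; nra.
Qed.

(** Testing lateness at x = 0 gives s W(y) <= F(y) <= A W(y) + B for some y >= t, and W(y) >= W(t) >
    0. *)
Lemma late_ub t s : oint 0 a t -> late t s -> s <= `|A| + `|B| / W t.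
Proof.
move=> It [s0 /(_ 0)]; have t0 := oint_gt0 It.
rewrite lexx ltW// => /(_ isT)[y [dy ty]].
rewrite /excess F0 W0 mulr0 subr0 subr_ge0 => sF.
have Wt0 : 0 < W t by rewrite -W0; apply: Wlt => //; exact: oint_dom.
have WtWy : W t <= W y by apply: Wle => //; exact: ltW.
have := FAB dy; have := ler_norm A; have := ler_norm B.
have -> : `|A| + `|B| / W t = (`|A| * W t + `|B|) / W t by field; rewrite gt_eqF.
rewrite ler_pdivlMr//.
have : s * W y <= `|A| * W y + `|B| -> s * W t <= `|A| * W t + `|B|.
  have [sA|As] := leP s `|A|.
    by move=> _; have := normr_ge0 B; nra.
  by nra.
by move=> H; nra.
Qed.

Lemma late_has_sup t : oint 0 a t -> has_sup (late t).
Proof.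
move=> It; split; first by exists 0; exact/late0/oint_dom.
by exists (`|A| + `|B| / W t) => s; exact: late_ub.
Qed.

Lemma late_lt t s : oint 0 a t -> 0 <= s -> s < slope t -> late t s.
Proof.
move=> It s0 /(sup_gt (late_has_sup It).1)[s' ls' /ltW ss'].
exact: late_le ls'.
Qed.

Lemma slope_ge0 t : oint 0 a t -> 0 <= slope t.
Proof. by move=> It; apply: ub_le_sup; [case: (late_has_sup It)|exact/late0/oint_dom]. Qed.

Lemma late_gt t s : oint 0 a t -> slope t < s ->
  exists x, 0 <= x <= t /\ forall y, dom y -> t <= y -> excess s y < excess s x.
Proof.
move=> It ts; apply: contrapT => H.
suff /(ub_le_sup (late_has_sup It).2) : late t s by rewrite -/(slope t) leNgt ts.
split=> [|x xt]; first by rewrite (le_trans (slope_ge0 It))// ltW.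
apply: contrapT => H'; apply: H; exists x; split=> // y dy ty.
by rewrite ltNge; apply/negP => xy; apply: H'; exists y.
Qed.

Lemma slope_le t t' : oint 0 a t -> oint 0 a t' -> t <= t' -> slope t' <= slope t.
Proof.
move=> It It' tt'; apply: sup_le; [|by case: (late_has_sup It')|exact: late_has_sup].
move=> s [s0 H]; apply/downP; exists s => //; split=> // x /andP[x0 xt].
have [|y [dy ty xy]] := H x; first by rewrite x0 (le_trans xt).
by exists y; split=> //; exact: le_trans ty.
Qed.

Lemma excess_cont s : continuous (excess s).
Proof. by move=> x; apply: cvgB; [exact: Fc|apply: cvgM; [exact: cvg_cst|exact: Wc]]. Qed.

Lemma argmax_on s t : dom t ->
  exists x, 0 <= x <= t /\ forall y, 0 <= y <= t -> excess s y <= excess s x.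
Proof.
case=> t0 _; have [|x xt H] := @EVT_max R (excess s) 0 t t0.
  by apply: continuous_subspaceT; exact: excess_cont.
by exists x; split; [rewrite in_itv/= in xt|move=> y yt; apply: H; rewrite in_itv].
Qed.

(** Take x maximising the excess on [0, t]. A better y > t would survive a slightly larger s,
    against [late_gt]. A larger slope at some t' in (x, t] would let a later point beat x for some s
    above [slope t], hence also for [slope t], as W increases. *)
Lemma argmax_attained t : oint 0 a t -> exists x, [/\ 0 <= x <= t,
  is_argmax (slope t) x & forall t', x < t' -> t' <= t -> slope t' = slope t].
Proof.
move=> It; have dt := oint_dom It.
have [x [/[dup] xt /andP[x0 xt'] H]] := argmax_on (slope t) dt.
have amx : is_argmax (slope t) x.
  split; first exact: dom_le dt.
  move=> y dy; have [yt|/ltW ty] := leP y t; first by apply: H; rewrite yt; case: dy => ->.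
  rewrite leNgt; apply/negP => xy.
  have Wy := W_ge0 dy; set e := excess (slope t) y - excess (slope t) x.
  have e0 : 0 < e by rewrite subr_gt0.
  have Wy1 : 0 < W y + 1 by lra.
  (* Raising s by e / (W y + 1) costs y less than its lead e. *)
  have [|z [/[dup] zt /andP[z0 zt'] /(_ y dy ty)]] := @late_gt t (slope t + e / (W y + 1)) It.
    by rewrite ltrDl divr_gt0.
  have := H z zt; have := W_ge0 (dom_le z0 zt' dt).
  have : e / (W y + 1) * W y < e.
    by rewrite mulrAC ltr_pdivrMr// ltr_pM2l//; lra.
  have : 0 < e / (W y + 1) by rewrite divr_gt0.
  by rewrite /e /excess; nra.
exists x; split=> // t' xt'' t't; have It' := oint_lt (le_lt_trans x0 xt'') t't It.
apply/eqP; rewrite eq_le; apply/andP; split; last exact: slope_le.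
rewrite leNgt; apply/negP => tt'.
have [|//|_ /(_ x)] := @late_lt t' ((slope t + slope t') / 2) It'; [|lra|].
  by have := slope_ge0 It; lra.
rewrite x0 ltW// => /(_ isT)[y [dy ty]].
have := amx.2 y dy; have : W x < W y by apply: Wlt => //; exact: lt_le_trans ty.
by rewrite /excess; nra.
Qed.

(** As s > slope t2, all maximisers lie before t2; as s < slope t1, one can be found from t1 on. *)
Lemma argmax_between t1 t2 s : oint 0 a t1 -> oint 0 a t2 -> t1 <= t2 ->
  slope t2 < s -> s < slope t1 -> exists x, [/\ t1 <= x, x < t2 & is_argmax s x].
Proof.
move=> It1 It2 t12 s2 s1.
have s0 : 0 <= s by rewrite (le_trans (slope_ge0 It2))// ltW.
have [x0 [x0t H0]] := late_gt It2 s2.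
have [z [zt Hz]] := argmax_on s (oint_dom It2).
have Hz' y : dom y -> t2 <= y -> excess s y < excess s z.
  by move=> dy ty; apply: (lt_le_trans (H0 y dy ty)); exact: Hz.
have amz : is_argmax s z.
  split; first by case/andP: zt => z0 zt2; exact: dom_le zt2 (oint_dom It2).
  move=> y dy; have [yt|/ltW ty] := leP y t2; last exact/ltW/Hz'.
  by apply: Hz; rewrite yt; case: dy => ->.
have [t1z|zt1] := leP t1 z.
  exists z; split=> //; rewrite ltNge; apply/negP => /(Hz' z amz.1).
  by rewrite ltxx.
have [_ /(_ z)] := late_lt It1 s0 s1.
rewrite (ltW zt1) amz.1.1 => /(_ isT)[y [dy ty zy]].
exists y; split=> //.
  by rewrite ltNge; apply/negP => /(Hz' y dy); rewrite ltNge zy.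
by split=> // u du; apply: le_trans zy; exact: amz.2.
Qed.

(** Comparisons of excesses pass to the limit s -> c from below, x -> b. The end points of plateaus
    are reached in this way. *)
Lemma excess_closed c b y : dom b -> dom y -> (forall e, 0 < e -> exists s x,
    [/\ c - e <= s, s <= c, dom x, `|b - x| < e & excess s y <= excess s x]) ->
  excess c y <= excess c b.
Proof.
move=> db dy H; apply/ler_addgt0Pr => e e0.
have Wb := W_ge0 db; have W1 : 0 < W b + 1 by lra.
have e2 : 0 < e / 2 by lra.
have := @excess_cont c b; move/(@cvgrPdist_lt _ R^o)/(_ _ e2) => [d1 /= d10 H1].
have := @Wc b; move/(@cvgrPdist_lt _ R^o)/(_ _ ltr01) => [d2 /= d20 H2].
(* Near b one has W x < W b + 1, so moving s by this amount changes the excess at x by at most e /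
   2. *)
have e3 : 0 < e / 2 / (W b + 1) by rewrite divr_gt0.
have [|s [x [cs sc dx bx sxy]]] := H (Num.min (Num.min d1 d2) (e / 2 / (W b + 1))).
  by rewrite !lt_min d10 d20.
move: bx; rewrite !lt_min => /andP[/andP[/H1 + /H2 +] _].
rewrite !ltr_norml => /andP[h1 h2] /andP[h3 h4].
have {cs} : c - (e / 2 / (W b + 1)) <= s.
  by apply: le_trans cs; rewrite lerD2l lerN2 ge_min lexx orbT.
have ce : e / 2 / (W b + 1) * (W b + 1) = e / 2 by rewrite divfK// gt_eqF.
have := W_ge0 dx; have := W_ge0 dy.
move: ce e3 h1 h2 h3 h4 sxy; set q := e / 2 / _; rewrite /excess => *.
have : (c - s) * (W x - W y) <= e / 2.
  have : (c - s) * (W x - W y) <= (c - s) * W x by nra.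
  have : (c - s) * W x <= q * W x by nra.
  by nra.
lra.
Qed.

Definition lo (c : R) : R := inf (plateau c).
Definition hi (c : R) : \bar R := ereal_sup (EFin @` plateau c).

Lemma lo_le c t : plateau c t -> lo c <= t.
Proof.
move=> pt; apply: ge_inf => //; exists 0 => u [/oint_gt0/ltW]//.
Qed.

Lemma lo_ge0 c t : plateau c t -> 0 <= lo c.
Proof. by move=> pt; apply: lb_le_inf; [exists t|move=> u [/oint_gt0/ltW]]. Qed.

Lemma hi_ge c t : plateau c t -> (t%:E <= hi c)%E.
Proof. by move=> pt; apply: ereal_sup_ubound; exists t. Qed.

Lemma hi_le c : (hi c <= a)%E.
Proof. by apply: ge_ereal_sup => _ [u [/andP[_ /ltW ua] _] <-]. Qed.

(** A plateau point u near [lo c] has a maximiser x <= u with slope c on (x, u]. Hence x is not left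
    of [lo c], and [excess_closed] applies. *)
Lemma lo_argmax c t : plateau c t -> is_argmax c (lo c).
Proof.
move=> pt; have dlo : dom (lo c).
  exact: dom_le (lo_ge0 pt) (lo_le pt) (oint_dom pt.1).
split=> // y dy; apply: excess_closed => // e e0.
have [|u pu ue] := @inf_adherent _ (plateau c) e e0.
  by split; [exists t|exists 0 => u [/oint_gt0/ltW]].
have [Iu uc] := pu.
have [x [/andP[x0 xu] amx H]] := argmax_attained Iu.
exists c, x; split=> //; first by lra.
- by case: amx.
- have lox : lo c <= x.
    rewrite leNgt; apply/negP => xlo.
    have lou := lo_le pu.
    have : plateau c ((x + lo c) / 2).
      have Im : oint 0 a ((x + lo c) / 2).
        by apply: (oint_lt _ _ Iu); lra.
      by split=> //; apply: etrans uc; apply: H; lra.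
    by move/lo_le; lra.
  by rewrite -/(lo c) in ue; rewrite ltr_norml; apply/andP; split; lra.
- by rewrite -uc; exact: amx.2.
Qed.

Lemma between_ereal (b e : R) (c : \bar R) : (b%:E < c)%E -> 0 < e ->
  exists t, [/\ b < t, t < b + e & (t%:E < c)%E].
Proof.
case: c => [c| |]//; last by exists (b + e / 2); split; rewrite ?ltry//; lra.
rewrite lte_fin => bc e0; exists (b + Num.min e (c - b) / 2).
have : 0 < Num.min e (c - b) by rewrite lt_min e0 subr_gt0.
have : Num.min e (c - b) <= e by rewrite ge_min lexx.
have : Num.min e (c - b) <= c - b by rewrite ge_min lexx orbT.
by move=> *; split; rewrite ?lte_fin; lra.
Qed.

(** For c = 0 the excess is the nondecreasing F. For c > 0, each s just below c has a good
    competitor near b: from lateness of a plateau point if b = a, from [argmax_between] with a point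
    t2 just after b otherwise. *)
Lemma hi_argmax c t b : plateau c t -> hi c = b%:E -> is_argmax c b.
Proof.
move=> pt cb; have tb : t <= b by rewrite -lee_fin -cb; exact: hi_ge.
have c0 : 0 <= c by rewrite -pt.2; exact: slope_ge0 pt.1.
have [It _] := pt; have t0 := oint_gt0 It.
have db : dom b by split; [lra|rewrite -cb; exact: hi_le].
have [dlo lomax] := lo_argmax pt.
split=> // y dy; apply: le_trans (lomax y dy) _.
move: c0; rewrite le_eqVlt => /predU1P[c0|c0].
  have E z : excess c z = F z by rewrite /excess -c0 mul0r subr0.
  rewrite !E; apply: Fle => //; first exact: lo_ge0 pt.
  by apply: le_trans tb; exact: lo_le.
apply: excess_closed => // e e0.
have [u [pu ub eu]] : exists u, [/\ plateau c u, u <= b & b - e < u].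
  have : ((b - e)%:E < hi c)%E by rewrite cb lte_fin; lra.
  move/ereal_sup_gt => [_ [u pu <-]]; rewrite lte_fin => eu; exists u; split=> //.
  by rewrite -lee_fin -cb; exact: hi_ge.
have lou := lo_le pu; have lo0 := lo_ge0 pu.
have [Iu uc] := pu.
have := db.2; rewrite le_eqVlt => /predU1P[ba|ba].
  (* The maximum with 0 is taken because [late] asks for a nonnegative s. *)
  have [||_ /(_ (lo c))] := @late_lt u (Num.max 0 (c - e)) Iu.
  - by rewrite le_max lexx.
  - by rewrite uc gt_max c0; lra.
  rewrite lo0 lou => /(_ isT)[z [dz uz lz]].
  exists (Num.max 0 (c - e)), z; split=> //.
  - by rewrite le_max lexx orbT.
  - by rewrite ge_max; apply/andP; split; lra.
  - have : z <= b by rewrite -lee_fin ba; case: dz.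
    by move=> zb; rewrite ltr_norml; apply/andP; split; lra.
have [t2 [bt2 t2e t2a]] := between_ereal ba e0.
have It2 : oint 0 a t2 by apply/andP; rewrite lte_fin; split=> //; lra.
have t2c : slope t2 < c.
  rewrite lt_neqAle; apply/andP; split; last by rewrite -uc; apply: slope_le => //; lra.
  apply/eqP => t2c; have /hi_ge : plateau c t2 by [].
  by rewrite cb lee_fin; lra.
have [|||x [ux xt2 [dx Hx]]] := @argmax_between u t2
    (Num.max ((slope t2 + c) / 2) (c - e / 2)) Iu It2.
- by lra.
- by rewrite lt_max; apply/orP; left; lra.
- by rewrite uc gt_max; apply/andP; split; lra.
exists (Num.max ((slope t2 + c) / 2) (c - e / 2)), x; split=> //.
- by rewrite le_max; apply/orP; right; lra.
- by rewrite ge_max; apply/andP; split; lra.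
- by rewrite ltr_norml; apply/andP; split; lra.
- exact: Hx.
Qed.

Lemma plateau_itv c t : oint (lo c)%:E (hi c) t -> plateau c t.
Proof.
case/andP; rewrite lte_fin => lot /ereal_sup_gt[_ [u pu <-]].
rewrite lte_fin => tu; have [Iu uc] := pu.
have [|l pl lt] := @inf_lt _ (plateau c) t _ lot; first by exists u.
have It : oint 0 a t.
  by apply: (oint_lt _ (ltW tu) Iu); apply: le_lt_trans lot; exact: lo_ge0 pu.
split=> //; apply/eqP; rewrite eq_le; apply/andP; split.
  by rewrite -pl.2; apply: slope_le; [exact: pl.1|by []|exact: ltW].
by rewrite -uc; apply: slope_le => //; exact: ltW.
Qed.

(* Level intervals with ratio [s], uniformly in the two kinds of right end point:
   the last clause says [R(al, b) >= s] if [b] is finite, and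
   [limsup R(al, t) >= s] if [b = +oo]. *)
Definition level_at (al : R) (b : \bar R) (s : R) : Prop :=
  [/\ 0 <= al, (al%:E < b)%E, (b <= a)%E, 0 < s &
   (forall r, al <= r -> (r%:E <= b)%E -> F r - F al <= s * (W r - W al)) /\
   (forall s' T, s' < s -> (T%:E < b)%E ->
      exists r, [/\ T < r, (r%:E <= b)%E & s' * (W r - W al) <= F r - F al])].

Lemma level_oint al b s t : level_at al b s -> oint al%:E b t -> oint 0 a t.
Proof.
case=> al0 _ ba _ _ /andP[]; rewrite lte_fin => alt tb; apply/andP.
by rewrite lte_fin (le_lt_trans al0)//; split=> //; exact: lt_le_trans ba.
Qed.

(** If the slope dropped, two maximisers x1, x2 in [t1, t2) would exist for intermediate values. The
    one with the larger value shows that s exceeds the smaller value S. From x1 on, F gains at most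
    S per unit of W, so the ratios R(al, r) with r > t2 stay below s by a fixed margin, against the
    last clause of [level_at]. *)
Lemma level_slope_const al b s t1 t2 : level_at al b s ->
  oint al%:E b t1 -> oint al%:E b t2 -> t1 <= t2 -> slope t1 = slope t2.
Proof.
move=> lev o1 o2 t12; have I1 := level_oint lev o1; have I2 := level_oint lev o2.
case: lev => al0 alb ba s0 [lev1 lev2].
apply/eqP; rewrite eq_le; apply/andP; split; last exact: slope_le.
rewrite leNgt; apply/negP => sl.
set d := slope t1 - slope t2; have d0 : 0 < d by rewrite subr_gt0.
have [||x2 [t1x2 x2t2 am2]] := @argmax_between t1 t2 (slope t2 + d * 2 / 3) I1 I2 t12.
- by lra.
- by rewrite /d; lra.
have [||x1 [t1x1 x1t2 am1]] := @argmax_between t1 t2 (slope t2 + d / 3) I1 I2 t12.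
- by lra.
- by rewrite /d; lra.
move: o1 o2 => /andP[]; rewrite lte_fin => alt1 t1b /andP[]; rewrite lte_fin => alt2 t2b.
have dal : dom al by apply: (dom_le al0 _ (oint_dom I1)); exact: ltW.
have Wx2 : W al < W x2 by apply: Wlt am2.1 => //; lra.
have s2 : slope t2 + d * 2 / 3 <= s.
  have x2b : (x2%:E <= b)%E by apply/ltW; apply: lt_trans t2b; rewrite lte_fin.
  have := lev1 x2 _ x2b; have := am2.2 al dal; rewrite /excess => h1.
  have alx2 : al <= x2 by lra.
  move/(_ alx2) => h2; rewrite -subr_ge0 -(@pmulr_rge0 _ (W x2 - W al)); last lra.
  by nra.
set S := slope t2 + d / 3 in am1; set e0 := s - S.
have e00 : 0 < e0 by rewrite /e0 /S; lra.
have Wx1 : W al < W x1 by apply: Wlt am1.1 => //; lra.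
have dt2 := oint_dom I2.
have y00 : 0 < W t2 - W x1.
  by rewrite subr_gt0; apply: Wlt => //; case: am1 => -[].
set X := W x1 - W al; set y0 := W t2 - W x1 in y00.
have X0 : 0 < X by rewrite /X; lra.
have q0 : 0 < X + y0 by lra.
(* With Y the W-length from x1 to r, the ratio is at most s - e0 Y / (X + Y). This deficit increases
   with Y > y0; e is half its value at y0, hence a margin uniform in r. *)
set e := e0 * y0 / (2 * (X + y0)).
have e_gt0 : 0 < e by rewrite divr_gt0 ?mulr_gt0.
have eE : e * (X + y0) * 2 = e0 * y0 by rewrite /e; field; rewrite gt_eqF.
have [|r [t2r rb]] := @lev2 (s - e) t2 _ t2b; first lra.
have dr : dom r by split; [have := oint_gt0 I2; lra|exact: le_trans rb ba].
have x1b : (x1%:E <= b)%E by apply/ltW; apply: lt_trans t2b; rewrite lte_fin.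
have alx1 : al <= x1 by lra.
have := lev1 x1 alx1 x1b; have := am1.2 r dr.
have : W t2 < W r by apply: Wlt => //; case: dt2.
rewrite /excess => h1 h2 h3 h4.
set Y := W r - W x1.
have Yy : y0 < Y by rewrite /Y /y0; lra.
have h5 : F r - F x1 <= S * Y by rewrite /Y; lra.
have h6 : (s - e) * (X + Y) - s * X <= F r - F x1.
  have -> : X + Y = W r - W al by rewrite /X /Y; ring.
  by rewrite /X; lra.
have h7 : (e0 - e) * Y <= e * X by rewrite /e0; nra.
have ee : e < e0.
  have : e * (2 * (X + y0)) < e0 * (2 * (X + y0)) -> e < e0 by rewrite ltr_pM2r//; lra.
  by apply; nra.
have : (e0 - e) * y0 < (e0 - e) * Y by rewrite ltr_pM2l// subr_gt0.
nra.
Qed.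

Lemma level_plateau al b s t : level_at al b s -> oint al%:E b t ->
  oint al%:E b `<=` plateau (slope t).
Proof.
move=> lev ot u ou; split; first exact: (level_oint lev).
have [ut|/ltW tu] := leP u t; first exact: (level_slope_const lev).
by apply/esym/(level_slope_const lev).
Qed.

(** A level interval lies in one plateau, so none is larger than the interior of a plateau; this
    yields maximality. *)
Lemma level_sub al b s t : level_at al b s -> oint al%:E b t ->
  lo (slope t) <= al /\ (b <= hi (slope t))%E.
Proof.
move=> lev ot; have sub := level_plateau lev ot.
have /andP[] := ot; rewrite lte_fin => alt tb; split.
  apply/ler_addgt0Pr => e e0; have [u [au ue ut]] := @between_ereal al e t%:E alt e0.
  have : lo (slope t) <= u.
    by apply/lo_le/sub/andP; split; [rewrite lte_fin|exact: lt_trans ut tb].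
  by move/le_trans; apply; exact: ltW.
rewrite leNgt; apply/negP => hb.
have [u] : exists u : R, (hi (slope t) < u%:E < b)%E /\ t <= u.
  have : (t%:E <= hi (slope t))%E by apply/hi_ge/sub.
  move: hb; case: (hi _) => [h| |]//; last by case: (b).
  rewrite lee_fin => /between_ereal/(_ ltr01)[u [hu _ ub]] th; exists u.
  by rewrite ub lte_fin hu; split=> //; lra.
move=> [/andP[hu ub] tu]; have /hi_ge : plateau (slope t) u.
  by apply: sub; apply/andP; split=> //; rewrite lte_fin; lra.
by rewrite leNgt hu.
Qed.

(** With slope 0, F would be constant from [lo 0] on, whereas a positive level makes it grow. *)
Lemma level_slope_gt0 al b s t : level_at al b s -> oint al%:E b t -> 0 < slope t.
Proof.
move=> lev ot; have It := level_oint lev ot.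
rewrite lt_neqAle slope_ge0// andbT; apply/eqP => t0.
have [loal _] := level_sub lev ot.
have pt := level_plateau lev ot ot.
have lo0 := lo_ge0 pt; have [_ lomax] := lo_argmax pt.
case: lev => al0 alb ba s0 [lev1 lev2]; have /andP[] := ot; rewrite lte_fin => alt tb.
have [|r [tr rb]] := @lev2 (s / 2) t _ tb; first lra.
have dr : dom r by split; [lra|exact: le_trans ba].
have dal : dom al by apply: (dom_le al0 _ dr); lra.
have := lomax r dr; have := Fle lo0 loal dal.
have : W al < W r by apply: Wlt => //; lra.
rewrite /excess -t0; nra.
Qed.

(** The upper bound is maximality at [lo c]. The lower one is maximality at [hi c] or, on an
    unbounded plateau, lateness of its points for every s' < c. *)
Lemma plateau_level c t : plateau c t -> 0 < c -> ((lo c)%:E < hi c)%E ->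
  level_at (lo c) (hi c) c.
Proof.
move=> pt c0 lohi; have [dlo lomax] := lo_argmax pt.
have lo0 := lo_ge0 pt; split=> //; first exact: hi_le.
split=> [r lor rh|s' T s'c Th].
  have dr : dom r by split; [lra|exact: le_trans (hi_le c)].
  by have := lomax r dr; rewrite /excess; lra.
case hE : (hi c) => [h| |]; last 2 first.
- have : ((Num.max T (lo c))%:E < hi c)%E by rewrite hE ltry.
  move=> /ereal_sup_gt[_ [u pu <-]]; rewrite lte_fin gt_max => /andP[Tu lou].
  have [Iu uc] := pu.
  have [||_ /(_ (lo c))] := @late_lt u (Num.max 0 s') Iu.
  + by rewrite le_max lexx.
  + by rewrite uc gt_max c0.
  rewrite lo0 (ltW lou) => /(_ isT)[y [dy uy ly]]; exists y; rewrite leey; split=> //; first lra.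
  have := Wle lo0 (le_trans (ltW lou) uy) dy.
  have : s' <= Num.max 0 s' by rewrite le_max lexx orbT.
  by move: ly; rewrite /excess; nra.
- by move: lohi; rewrite hE.
have [dh hmax] := hi_argmax pt hE.
move: lohi Th; rewrite hE !lte_fin => loh Th; exists h; rewrite lexx; split=> //.
have := hmax _ dlo; have := Wle lo0 (ltW loh) dh.
by rewrite /excess; nra.
Qed.

End level_sets.

(** * Integrals of decreasing functions *)

Section monotone_measurable.
Variables (R : realType).
Implicit Types (J : set R) (h : R -> \bar R).

Lemma is_interval_oint (x y : \bar R) : is_interval (oint x y).
Proof.
move=> s t /andP[xs sy] /andP[xt ty] u /andP[su ut].
by apply/andP; split; [apply: lt_le_trans xs _|apply: le_lt_trans ty]; rewrite lee_fin.
Qed.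

Lemma measurable_oint (x y : \bar R) : measurable (oint x y).
Proof. by apply: is_interval_measurable; exact: is_interval_oint. Qed.

Lemma nonincreasing_in_measurable J h : is_interval J ->
  (forall s t, J s -> J t -> s <= t -> (h t <= h s)%E) -> measurable_fun J h.
Proof.
move=> iJ hJ mJ; apply: (measurability _ (ErealGenCInfty.measurableE R)) => //.
move=> _ [_ [x ->] <-]; apply: is_interval_measurable => s t/= [Js hs] [Jt ht] u sut.
have Ju : J u by exact: iJ sut.
split=> //; move: ht; rewrite /= !in_itv/= !andbT => /le_trans; apply.
by apply: hJ => //; case/andP: sut.
Qed.

Lemma ge0_integral_itv_split (x y z : R) h : x <= y -> y <= z ->
  measurable_fun `]x, z[ h -> (forall t, x < t -> t < z -> (0 <= h t)%E) ->
  (\int[lebesgue_measure]_(t in `]x, z[) h t = \int[lebesgue_measure]_(t in `]x, y[) h t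
   + \int[lebesgue_measure]_(t in `]y, z[) h t)%E.
Proof.
move=> xy; rewrite le_eqVlt => /predU1P[->|yz] mh h0.
  by rewrite [X in (_ + X)%E](_ : _ = 0%E) ?adde0// set_itvoo0 integral_set0.
have E : [set` `]x, z[] = [set` `]x, y]] `|` [set` `]y, z[].
  by apply: itv_bndbnd_setU; rewrite bnd_simp.
rewrite [X in (_ = X + _)%E]integral_itv_bndo_bndc; last first.
  by apply: measurable_funS mh => // t /=; rewrite !in_itv/= => /andP[-> /lt_trans]; apply.
rewrite E ge0_integral_setU//.
- by rewrite -E.
- by rewrite -E => t /=; rewrite in_itv/= => /andP[]; exact: h0.
- rewrite disj_set2E; apply/eqP/seteqP; split=> // t/= []; rewrite !in_itv/= => /andP[_ ty] /andP[].
  by rewrite ltNge ty.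
Qed.

Lemma eq_lebesgue_integral (D : set R) (f g : R -> \bar R) : (forall x, D x -> f x = g x) ->
  (\int[lebesgue_measure]_(x in D) f x = \int[lebesgue_measure]_(x in D) g x)%E.
Proof. by move=> fg; apply: eq_integral => x /set_mem; exact: fg. Qed.

Lemma integral_itv_cst (x y c : R) : x <= y ->
  (\int[lebesgue_measure]_(t in `]x, y[) c%:E = (c * (y - x))%:E)%E.
Proof.
move=> xy; have -> : (\int[lebesgue_measure]_(t in `]x, y[) c%:E =
    c%:E * lebesgue_measure (`]x, y[%classic : set R))%E by apply: integral_cst.
rewrite lebesgue_measure_itv/= lte_fin.
by move: xy; rewrite le_eqVlt => /predU1P[->|->]; rewrite ?ltxx ?subrr ?mulr0 ?mule0.
Qed.

End monotone_measurable.

Section primitive.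
Variables (R : realType) (a : \bar R) (k : R -> R).

Record decreasing_on : Prop := DecreasingOn {
  dec_gt0 : (0 < a)%E;
  dec_ge0 : forall t, oint 0 a t -> 0 <= k t;
  dec_le : forall s t, oint 0 a s -> oint 0 a t -> s <= t -> k t <= k s;
  dec_fin : forall t, oint 0 a t ->
    (\int[lebesgue_measure]_(s in `]0%R, t[) (k s)%:E < +oo)%E }.

Hypothesis kP : decreasing_on.
Let a_gt0 := dec_gt0 kP.
Let k_ge0 := dec_ge0 kP.
Let k_le := dec_le kP.
Let k_fin := dec_fin kP.

Local Notation mu := (@lebesgue_measure R).
Let k0 : R -> \bar R := (EFin \o k) \_ (oint 0 a).

Lemma k0E t : oint 0 a t -> k0 t = (k t)%:E.
Proof. by move=> It; rewrite /k0 patchE mem_set. Qed.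

Lemma k0_ge0 t : (0 <= k0 t)%E.
Proof. by rewrite /k0 patchE; case: ifPn => // /set_mem/k_ge0; rewrite lee_fin. Qed.

Lemma measurable_decr J : measurable J -> J `<=` oint 0 a -> measurable_fun J (EFin \o k).
Proof.
move=> mJ sJ; apply: (@measurable_funS _ _ _ _ (oint 0 a)) => //; first exact: measurable_oint.
apply: nonincreasing_in_measurable; first exact: is_interval_oint.
by move=> s t Is It st; rewrite lee_fin; exact: k_le.
Qed.

Lemma measurable_k0 : measurable_fun setT k0.
Proof.
apply/(measurable_restrictT (EFin \o k)); first exact: measurable_oint.
by apply: measurable_decr => //; exact: measurable_oint.
Qed.

(** Beyond a point t of I the function is bounded by [k t], so the primitive is finite at a finite
    end point a as well. *)
Lemma int_k0_fin y : (\int[mu]_(t in `]0%R, y[) k0 t < +oo)%E.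
Proof.
have [t [t0 _ ta]] := between_ereal a_gt0 (ltr01 : 0 < 1 :> R).
have It : oint 0 a t by apply/andP; rewrite lte_fin.
have Et : (\int[mu]_(t in `]0%R, t[) k0 t < +oo)%E.
  rewrite (@eq_lebesgue_integral _ _ _ (EFin \o k)); first exact: k_fin.
  move=> u; rewrite /= in_itv/= => /andP[u0 ut]; apply: k0E.
  exact: oint_lt (ltW ut) It.
have [yt|/ltW ty] := leP y t.
  apply: le_lt_trans Et; apply: ge0_subset_integral => //.
  - by apply: measurable_funTS; exact: measurable_k0.
  - by move=> *; exact: k0_ge0.
  - by move=> u /=; rewrite !in_itv/= => /andP[-> /lt_le_trans]; exact.
rewrite (@ge0_integral_itv_split _ 0 t y)//; last 3 first.
- exact: ltW.
- by apply: measurable_funTS; exact: measurable_k0.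
- by move=> *; exact: k0_ge0.
apply: lte_add_pinfty => //.
apply: (@le_lt_trans _ _ (\int[mu]_(s in `]t, y[) (k t)%:E)%E).
  apply: ge0_le_integral => //.
  - by move=> *; exact: k0_ge0.
  - by apply: measurable_funTS; exact: measurable_k0.
  - move=> u /=; rewrite in_itv/= => /andP[tu _]; rewrite /k0 patchE; case: ifPn => [/set_mem Iu|_].
      by rewrite lee_fin; apply: k_le => //; exact: ltW.
    by rewrite lee_fin; exact: k_ge0.
by rewrite integral_itv_cst// ltry.
Qed.

Definition prim (x : R) : R := fine (\int[mu]_(t in `]0%R, x[) k0 t).

Lemma primE x : (prim x)%:E = (\int[mu]_(t in `]0%R, x[) k0 t)%E.
Proof.
by rewrite fineK// ge0_fin_numE ?int_k0_fin//; apply: integral_ge0 => *; exact: k0_ge0.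
Qed.

Lemma prim0 : prim 0 = 0.
Proof. by rewrite /prim set_itvoo0 integral_set0. Qed.

Lemma prim_integral x y : 0 <= x -> x <= y -> dom a y ->
  (\int[mu]_(t in `]x, y[) (k t)%:E = (prim y - prim x)%:E)%E.
Proof.
move=> x0 xy dy; rewrite (@eq_lebesgue_integral _ _ _ k0); last first.
  move=> u; rewrite /= in_itv/= => /andP[xu uy]; rewrite k0E//.
  by apply: dom_oint dy => //; exact: le_lt_trans xu.
have := primE y; rewrite (@ge0_integral_itv_split _ 0 x y)//; last 2 first.
- by apply: measurable_funTS; exact: measurable_k0.
- by move=> *; exact: k0_ge0.
rewrite -primE EFinB => ->; rewrite addeAC subee ?add0e//.
Qed.

Lemma measurable_itv_k x y : 0 <= x -> dom a y -> measurable_fun `]x, y[ (EFin \o k).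
Proof.
move=> x0 dy; apply: measurable_decr => // u /=; rewrite in_itv/= => /andP[xu uy].
by apply: dom_oint dy => //; exact: le_lt_trans xu.
Qed.

Lemma prim_ge x y : 0 <= x -> x <= y -> oint 0 a y -> k y * (y - x) <= prim y - prim x.
Proof.
move=> x0 xy Iy; have dy := oint_dom Iy; rewrite -lee_fin -prim_integral//.
have -> : (k y * (y - x))%:E = (\int[mu]_(s in `]x, y[) (k y)%:E)%E.
  by rewrite integral_itv_cst.
apply: ge0_le_integral => //.
- by move=> *; rewrite lee_fin; exact: k_ge0.
- exact: measurable_itv_k.
- move=> u /=; rewrite in_itv/= => /andP[xu uy]; rewrite lee_fin; apply: k_le => //; last exact: ltW.
  by apply: oint_lt (ltW uy) Iy; exact: le_lt_trans xu.
Qed.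

Lemma prim_le x y : oint 0 a x -> x <= y -> dom a y -> prim y - prim x <= k x * (y - x).
Proof.
move=> Ix xy dy; have x0 := ltW (oint_gt0 Ix); rewrite -lee_fin -prim_integral//.
have -> : (k x * (y - x))%:E = (\int[mu]_(s in `]x, y[) (k x)%:E)%E.
  by rewrite integral_itv_cst.
have Iu u : `]x, y[%classic u -> oint 0 a u.
  rewrite /= in_itv/= => /andP[xu uy].
  by apply: dom_oint dy => //; exact: le_lt_trans xu.
apply: ge0_le_integral => //.
- by move=> u /Iu/k_ge0; rewrite lee_fin.
- exact: measurable_itv_k.
- move=> u /[dup] /Iu Iu'; rewrite /= in_itv/= => /andP[xu uy]; rewrite lee_fin; apply: k_le => //.
  exact: ltW.
Qed.

Lemma prim_mono x y : 0 <= x -> x <= y -> dom a y -> prim x <= prim y.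
Proof.
move=> x0 xy dy; rewrite -subr_ge0 -lee_fin -prim_integral//; apply: integral_ge0 => u /=.
rewrite in_itv/= lee_fin => /andP[xu uy]; apply: k_ge0.
by apply: dom_oint dy => //; exact: le_lt_trans xu.
Qed.

Lemma prim_continuous : continuous prim.
Proof.
(* As [k0] vanishes left of 0, the integral may start at - c; then x, even x = 0, is interior to
   [- c, c]. *)
move=> x; set c := `|x| + 1.
have c0 : 0 < c by rewrite /c; have := normr_ge0 x; lra.
have K0 t : t <= 0 -> k0 t = 0%E.
  by move=> t0; rewrite /k0 patchE memNset// => /oint_gt0; rewrite ltNge t0.
have mk J : measurable_fun J k0 by apply: measurable_funTS; exact: measurable_k0.
have E y : (prim y)%:E = (\int[mu]_(t in `[(- c)%R, y]) k0 t)%E.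
  rewrite primE [RHS]integral_itv_bndoo//.
  have [y0|y0] := leP y 0.
    rewrite set_itv_ge ?integral_set0 -?leNgt//.
    rewrite (@eq_lebesgue_integral _ _ _ (cst 0%E)) ?integral0// => u.
    by rewrite /= in_itv/= => /andP[_ uy]; apply: K0; apply: le_trans y0; exact: ltW.
  rewrite (@ge0_integral_itv_split _ (- c) 0 y)//; last 3 first.
  - lra.
  - exact: ltW.
  - by move=> *; exact: k0_ge0.
  rewrite [X in (X + _)%E](_ : _ = 0%E) ?add0e//.
  rewrite (@eq_lebesgue_integral _ _ _ (cst 0%E)) ?integral0// => u.
  by rewrite /= in_itv/= => /andP[_ /ltW/K0].
have k0f : k0 = EFin \o (fine \o k0).
  by apply/funext => t /=; rewrite /k0 patchE; case: ifP.
have := @parameterized_integral_continuous R (- c) c (fine \o k0).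
have cc : - c < c by lra.
rewrite -k0f (ltW cc) => /(_ isT) H.
have {}H : {within `[- c, c], continuous prim}.
  rewrite (_ : prim = fun y => parameterized_integral mu (- c) y (fine \o k0)).
    apply: H; apply/integrableP; split=> //; first exact: mk.
    rewrite (@eq_lebesgue_integral _ _ _ k0); last by move=> u _ /=; rewrite gee0_abs// k0_ge0.
    by rewrite -E ltry.
  apply/funext => y; rewrite /prim -[LHS]/(fine (prim y)%:E) E /parameterized_integral /Rintegral.
  by congr fine; apply: eq_lebesgue_integral => u _; rewrite [in LHS]k0f.
apply: (within_continuous_continuous cc H).
rewrite in_itv/=; have := ler_norm x; have := ler_norm (- x); rewrite normrN /c.
by move=> *; apply/andP; split; lra.
Qed.

End primitive.

(** * Exhaustion, comparison over level sets, rearrangement of almost monotone functions *)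

Section lebesgue_tools.
Variable R : realType.
Local Notation mu := (@lebesgue_measure R).
Implicit Types (h k : R -> \bar R) (N : set R) (b : \bar R) (x t : R).

(* [lebesgue_measure] is an outer measure on all sets, measurable or not. *)
Lemma le_lebesgue_measure (A B : set R) : A `<=` B -> (mu A <= mu B)%E.
Proof. by move=> AB; apply: le_mu_ext. Qed.

Lemma lebesgue_measure_itv0 t : 0 <= t -> mu (`]0, t[%classic : set R) = t%:E.
Proof.
move=> t0; rewrite lebesgue_measure_itv/= lte_fin.
by move: t0; rewrite le_eqVlt => /predU1P[<-|->]; rewrite ?ltxx ?sube0.
Qed.

Lemma integral_oint_sup b h (m : \bar R) : (0 < b)%E -> measurable_fun (oint 0 b) h ->
  (forall t, oint 0 b t -> (0 <= h t)%E) ->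
  (forall x, oint 0 b x -> (\int[mu]_(t in `]0%R, x[) h t <= m)%E) ->
  (\int[mu]_(t in oint 0 b) h t <= m)%E.
Proof.
move=> b0 mh h0 H.
have [u [ui ub uc]] : exists u : R^nat, [/\ nondecreasing_seq u,
    forall n, oint 0 b (u n) & forall t, oint 0 b t -> exists n, t < u n].
  case: b b0 {mh h0 H} => [b| |]//.
    rewrite lte_fin => b0; have c0 : 0 < b^-1 by rewrite invr_gt0.
    have n0 n : 0 < n.+2%:R :> R by rewrite ltr0n.
    have n2 n : n.+2%:R = n%:R + 2 :> R by rewrite -addn2 natrD.
    (* The shift to n + 2 makes the first term positive already. *)
    exists (fun n => b * (1 - n.+2%:R^-1)); split.
    - move=> m1 n1 mn; rewrite ler_pM2l// lerD2l lerN2 lef_pV2 ?posrE//.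
      by rewrite ler_nat.
    - move=> n; apply/andP; rewrite !lte_fin; split.
        rewrite mulr_gt0// subr_gt0 invf_lt1// n2.
        by have := ler0n R n; lra.
      by rewrite gtr_pMr// ltrBlDr ltrDl invr_gt0.
    - move=> t /andP[]; rewrite !lte_fin => t0 tb.
      have d0 : 0 < 1 - t / b by rewrite subr_gt0 ltr_pdivrMr// mul1r.
      have := archi_boundP (ltW (_ : 0 < (1 - t / b)^-1)); rewrite invr_gt0 => /(_ d0).
      set n := Num.Def.archi_bound _ => dn; exists n.
      have dn2 : (1 - t / b)^-1 < n.+2%:R by rewrite n2; lra.
      have : n.+2%:R^-1 < 1 - t / b.
        by rewrite -[ltRHS]invrK ltf_pV2// posrE ?invr_gt0.
      have tE : t = b * (t / b) by rewrite mulrC divfK// gt_eqF.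
      by move=> nt; rewrite [ltLHS]tE ltr_pM2l// ltrBrDr addrC -ltrBrDr.
  move=> _; exists (fun n => n.+1%:R); split.
  - by move=> m1 n1 mn; rewrite ler_nat ltnS.
  - by move=> n; apply/andP; rewrite lte_fin ltr0n ltry.
  - move=> t /andP[]; rewrite lte_fin => /ltW/archi_boundP tn _; exists (Num.Def.archi_bound t).
    by apply: lt_trans tn _; rewrite ltr_nat.
have sub n : `]0, u n[%classic `<=` oint 0 b.
  move=> t /=; rewrite in_itv/= => /andP[t0 tu].
  by apply: oint_lt (ltW tu) (ub n).
have E : oint 0 b = \bigcup_n `]0, u n[%classic.
  apply/seteqP; split=> [t It|t [n _ /sub//]].
  by have [n tn] := uc t It; exists n => //=; rewrite in_itv/= tn (oint_gt0 It).
rewrite E.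
apply: (cvge_le _ (ge0_nondecreasing_set_cvg_integral _ _ _ _)).
- by apply: nearW => n; exact: H.
- move=> m1 n1 mn; apply/subsetPset => t /=; rewrite !in_itv/= => /andP[-> /lt_le_trans].
  by apply; exact: ui.
- by move=> n; exact: measurable_itv.
- by move=> n; apply: measurable_funS mh; [exact: measurable_oint|exact: sub].
- by move=> n t /sub/h0.
Qed.

(** Only the level sets of s whose value is taken at a rational are compared by integrals; they are
    countably many, and off them the comparison is pointwise almost everywhere. *)
Lemma le_integral_plateaus (D : set R) (s : R -> R) h k N : measurable D ->
  measurable_fun D h -> measurable_fun D k ->
  (forall t, D t -> (0 <= h t)%E) -> (forall t, D t -> (0 <= k t)%E) -> countable N ->
  (forall c, measurable (D `&` [set t | s t = c])) ->
  (forall c, (\int[mu]_(t in D `&` [set t | s t = c]) h t <=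
              \int[mu]_(t in D `&` [set t | s t = c]) k t)%E) ->
  (forall t, D t -> ~ N t -> (forall q : rat, s t <> s (ratr q)) -> (h t <= k t)%E) ->
  (\int[mu]_(t in D) h t <= \int[mu]_(t in D) k t)%E.
Proof.
move=> mD mh mk h0 k0 cN mP HP HO.
(* A number coding no rational is sent to 0, which is harmless: [HP] holds for every value. *)
pose q n : R := if @unpickle rat n is Some r then ratr r else 0.
pose P n := D `&` [set t | s t = s (q n)].
pose U := \bigcup_n P n.
have UD : U `<=` D by move=> t [n _ []].
have mU : measurable U by apply: bigcupT_measurable => n; exact: mP.
have DU : D = U `|` D `\` U by rewrite setUDr setDv setD0; apply/esym/setUidr.
have split_int (f : R -> \bar R) : measurable_fun D f -> (forall t, D t -> (0 <= f t)%E) ->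
    (\int[mu]_(t in D) f t = \int[mu]_(t in U) f t + \int[mu]_(t in D `\` U) f t)%E.
  move=> mf f0; rewrite {1}DU ge0_integral_setU// -?DU//.
  - exact: measurableD.
  - by rewrite disj_set2E; apply/eqP/seteqP; split=> // t [? []].
have mPn n : measurable (seqDU P n).
  by apply: measurableD; [exact: mP|apply: bigsetU_measurable => i _; exact: mP].
have UE : U = \bigcup_n seqDU P n by rewrite -seqDU_bigcup_eq.
have sum_int (f : R -> \bar R) : measurable_fun D f -> (forall t, D t -> (0 <= f t)%E) ->
    (\int[mu]_(t in U) f t = \sum_(n <oo) \int[mu]_(t in seqDU P n) f t)%E.
  move=> mf f0; rewrite UE ge0_integral_bigcup// -?UE.
  - by apply: measurable_funS mf.
  - by move=> t /UD/f0.
rewrite (split_int h)// (split_int k)//; apply: leeD.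
  rewrite (sum_int h)// (sum_int k)//; apply: lee_nneseries => [n _ _|n _].
    by apply: integral_ge0 => t [[/h0]].
  (* Level sets are equal or disjoint, so removing the earlier ones leaves the whole set or
     nothing. *)
  have [->|->] : seqDU P n = P n \/ seqDU P n = set0; last by rewrite !integral_set0.
    have [[m mn mE]|H] := pselect (exists2 m, (m < n)%N & s (q m) = s (q n)).
      right; apply/seteqP; split=> // t [[Dt st]]; apply.
      by rewrite -bigcup_mkord; exists m => //; split=> //=; rewrite mE.
    left; apply/seteqP; split=> t; first by case.
    move=> Pt; split=> //; rewrite -bigcup_mkord => -[m /= mn [_ /= st]]; apply: H.
    by exists m => //; rewrite -st; case: Pt.
  exact: HP.
apply: ae_ge0_le_integral; rewrite ?/mu.
- exact: measurableD.
- by move=> t [/h0].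
- by apply: measurable_funS mh => // t [].
- by move=> t [/k0].
- by apply: measurable_funS mk => // t [].
exists N; split; [exact: countable_measurable|exact: countable_lebesgue_measure0|].
move=> t /= H; apply: contrapT => Nt; apply: H => -[Dt Ut]; apply: HO => // r st.
apply: Ut; exists (pickle r) => //; split=> //=.
by rewrite /q pickleK.
Qed.

Lemma countable_setU (A B : set R) : countable A -> countable B -> countable (A `|` B).
Proof.
move=> cA cB; rewrite -bigcup2E; apply: bigcup_countable => // -[|[|n]] _ //=.
Qed.

(** The intervals ]h t, k t[ with t in J are nonempty and pairwise disjoint, and each contains a
    rational. *)
Lemma rational_between h k (J : set R) :
  (forall t, J t -> (0 <= h t)%E) -> (forall t, J t -> (h t < k t)%E) ->
  (forall s t, J s -> J t -> s < t -> (k t <= h s)%E) -> countable J.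
Proof.
move=> h0 hk H.
have ex t : J t -> exists q : rat, (h t < (ratr q : R)%:E < k t)%E.
  move=> Jt; have := hk t Jt; have := h0 t Jt.
  case: (h t) => [x| |]//; case: (k t) => [y| |]// _.
    by rewrite lte_fin => /rat_in_itvoo[q]; rewrite in_itv/= => qxy; exists q; rewrite !lte_fin.
  move=> _; have /rat_in_itvoo[q] : x < x + 1 by lra.
  by rewrite in_itv/= => /andP[xq _]; exists q; rewrite lte_fin xq ltry.
have [f fP] : exists f : R -> rat, forall t, J t -> (h t < (ratr (f t) : R)%:E < k t)%E.
  have /choice[f fP] : forall t, exists q : rat, J t -> (h t < (ratr q : R)%:E < k t)%E.
    by move=> t; have [/ex[q qt]|nJ] := pselect (J t); [exists q|exists 0].
  by exists f.
apply/countable_injP; exists (pickle \o f) => s t /set_mem Js /set_mem Jt /= /(pcan_inj (@pickleK _)).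
have aux u v : J u -> J v -> f u = f v -> ~ u < v.
  move=> Ju Jv fuv uv; have /andP[hu _] := fP u Ju; have /andP[_ kv] := fP v Jv.
  by have := lt_trans hu; rewrite fuv => /(_ _ kv); rewrite ltNge H.
by move=> fst; have [/aux[]|/aux[]|] := ltgtP s t.
Qed.

(** Off N, the set where h exceeds h(t) + e lies in (0, t) up to a null set, so the rearrangement is
    at most h. For s < t, h is at least h(t) almost everywhere on (0, t), so the rearrangement at s
    is at least h(t). The gaps left are thus disjoint intervals, hence countable. *)
Lemma rearr_ae_nonincreasing b h N : countable N -> (forall t, oint 0 b t -> (0 <= h t)%E) ->
  (forall s t, oint 0 b s -> oint 0 b t -> ~ N s -> ~ N t -> s < t -> (h t <= h s)%E) ->
  exists2 N', countable N' & forall t, oint 0 b t -> ~ N' t -> rearr b h t = h t.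
Proof.
move=> cN h0 hle.
have mN : mu N = 0%E by exact: countable_lebesgue_measure0.
have mcN : measurable N by exact: countable_measurable.
have dE l : distr b h l = mu [set x | oint 0 b x /\ (l%:E < `|h x|)%E] by [].
have up t : oint 0 b t -> ~ N t -> (rearr b h t <= h t)%E.
  move=> It Nt; have := h0 t It; case ht : (h t) => [r| |]//; last by move=> _; rewrite leey.
  rewrite lee_fin => r0; apply/lee_addgt0Pr => e e0; apply: ereal_inf_lbound.
  exists (r + e) => //; split; first lra.
  have t0 := ltW (oint_gt0 It).
  rewrite dE; apply: (@le_trans _ _ (mu (`]0, t[%classic `|` N))).
    apply: le_lebesgue_measure => x [Ix]; rewrite gee0_abs ?h0// => hx.
    have [Nx|Nx] := pselect (N x); [by right|left].
    rewrite /= in_itv/= (oint_gt0 Ix)/= ltNge; apply/negP; rewrite le_eqVlt => /predU1P[tx|tx].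
      by move: hx; rewrite -tx ht lte_fin; lra.
    have := hle t x It Ix Nt Nx tx; rewrite leNgt ht => /negP; apply.
    by apply: lt_trans hx; rewrite lte_fin; lra.
  have -> : mu (`]0, t[%classic `|` N) = mu (`]0, t[%classic) by apply: measureU0.
  by rewrite lebesgue_measure_itv0.
have low s t : oint 0 b s -> oint 0 b t -> ~ N t -> s < t -> (h t <= rearr b h s)%E.
  move=> Is It Nt st; apply: le_ereal_inf_tmp => _ [l [l0 dl] <-].
  rewrite leNgt; apply/negP => lt; move: dl; apply/negP; rewrite -ltNge dE.
  apply: (@lt_le_trans _ _ (mu (`]0, t[%classic `\` N))).
    have -> : mu (`]0, t[%classic `\` N) = mu `]0, t[%classic.
      rewrite [RHS](measureDI mu _ mcN)//.
      rewrite [X in (_ = _ + X)%E](_ : _ = 0%E) ?adde0//.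
      by apply: subset_measure0 mN => //; apply: measurableI.
    by rewrite lebesgue_measure_itv0 ?lte_fin// ltW// (oint_gt0 It).
  apply: le_lebesgue_measure => x [/=]; rewrite in_itv/= => /andP[x0 xt] Nx.
  have Ix := oint_lt x0 (ltW xt) It.
  by split=> //; rewrite gee0_abs ?h0//; apply: lt_le_trans lt _; exact: hle.
exists (N `|` [set t | [/\ oint 0 b t, ~ N t & (rearr b h t < h t)%E]]).
  apply: countable_setU => //; apply: (@rational_between (rearr b h) h) => [t [It _ _]|t []//|].
    by apply: le_ereal_inf_tmp => _ [l [/ltW l0 _] <-]; rewrite lee_fin.
  by move=> s t [Is _ _] [It Nt _]; exact: low.
move=> t It /not_orP[Nt H]; apply/eqP; rewrite eq_le up//= leNgt; apply/negP => lt.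
by apply: H.
Qed.

End lebesgue_tools.

(** * Convex functions as mixtures of hinges *)

Section convex_majorization.
Variables (R : realType) (phi : R -> R).
Hypothesis phi_orlicz : orlicz_function phi.

Lemma phi_ge0 u : 0 <= u -> 0 <= phi u.
Proof.
case: phi_orlicz => _ p0 pgt; rewrite le_eqVlt => /predU1P[<-|/pgt/ltW//].
by rewrite p0.
Qed.

Lemma phi_chord (x y z : R) : 0 <= x -> x <= y -> y <= z ->
  phi y * (z - x) <= phi x * (z - y) + phi z * (y - x).
Proof.
case: phi_orlicz => pc _ _ x0 xy yz.
have [->|xz] := eqVneq x z; first by rewrite subrr mulr0; nra.
have d0 : 0 < z - x by rewrite subr_gt0 lt_neqAle xz (le_trans xy).
have p0 : 0 <= (z - y) / (z - x) by apply: divr_ge0; [rewrite subr_ge0|exact: ltW].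
have p1 : (z - y) / (z - x) <= 1 by rewrite ler_pdivrMr// mul1r lerD2l lerN2.
have := pc (Itv01 p0 p1) x z; rewrite !inE/= !in_itv/= !andbT => /(_ x0).
move=> /(_ (le_trans x0 (le_trans xy yz))).
rewrite convRE/= /conv/= /GRing.scale/= /unstable.onem.
have -> : (z - y) / (z - x) * x + (1 - (z - y) / (z - x)) * z = y.
  by field; rewrite gt_eqF.
have -> : (z - y) / (z - x) * phi x + (1 - (z - y) / (z - x)) * phi z =
    (phi x * (z - y) + phi z * (y - x)) / (z - x).
  by field; rewrite gt_eqF.
by rewrite ler_pdivlMr.
Qed.

Lemma phi_mono (x y : R) : 0 <= x -> x <= y -> phi x <= phi y.
Proof.
move=> x0 xy; have := phi_chord (lexx 0) x0 xy.
have := phi_ge0 (le_trans x0 xy); have := phi_ge0 x0; have [_ -> _] := phi_orlicz.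
move=> *; rewrite leNgt; apply/negP => lt; have : 0 < y; last by nra.
rewrite lt_neqAle (le_trans x0 xy) andbT; apply/eqP => y0.
by move: lt; have -> : x = y; [lra|rewrite ltxx].
Qed.

Section linear_interpolation.
Variable d : R.
Hypothesis d0 : 0 < d.

Definition chord_slope (k : nat) : R := (phi (k.+1%:R * d) - phi (k%:R * d)) / d.

(** The jump at k d of the slope of the interpolation, with slope 0 before 0: the mass given to one
    hinge, nonnegative by convexity. *)
Definition kink (k : nat) : R :=
  chord_slope k - (if k is k'.+1 then chord_slope k' else 0).

(* The piecewise linear interpolation of [phi] at the multiples of [d],
   delayed by [d] so that it stays below [phi]. *)
Definition delayed (K : nat) (u : R) : R :=
  \sum_(k < K) kink k * Num.max (u - k.+1%:R * d) 0.

Lemma kink_ge0 k : 0 <= kink k.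
Proof.
case: k => [|k]; rewrite /kink.
  rewrite subr0 divr_ge0 ?(ltW d0)// subr_ge0 phi_mono// ?mulr_ge0 ?ler0n ?(ltW d0)//.
  by rewrite ler_pM2r// ler_nat.
rewrite -mulrBl divr_ge0 ?(ltW d0)//.
have E n : n.+1%:R = n%:R + 1 :> R by rewrite -addn1 natrD.
have := @phi_chord (k%:R * d) (k.+1%:R * d) (k.+2%:R * d).
rewrite !(ler_pM2r d0) !ler_nat !leqnSn mulr_ge0 ?ler0n ?(ltW d0)// => /(_ isT isT isT).
have -> : k.+2%:R * d - k%:R * d = 2 * d by rewrite !E; ring.
have -> : k.+2%:R * d - k.+1%:R * d = d by rewrite !E; ring.
have -> : k.+1%:R * d - k%:R * d = d by rewrite !E; ring.
by move=> H; rewrite -(pmulr_lge0 _ d0); lra.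
Qed.

Lemma delayed_line K u : K.+1%:R * d <= u ->
  delayed K.+1 u = phi (K%:R * d) + chord_slope K * (u - K.+1%:R * d).
Proof.
elim: K => [|K IH] Ku; rewrite /delayed big_ord_recr/=.
  rewrite big_ord0 add0r /kink subr0 mul0r; have [_ -> _] := phi_orlicz.
  by rewrite add0r; congr (_ * _); apply/max_idPl; rewrite subr_ge0.
rewrite -/(delayed K.+1 u) IH; last by apply: le_trans Ku; rewrite ler_pM2r// ler_nat.
have -> : Num.max (u - K.+2%:R * d) 0 = u - K.+2%:R * d by apply/max_idPl; rewrite subr_ge0.
have E n : n.+1%:R = n%:R + 1 :> R by rewrite -addn1 natrD.
have -> : phi (K.+1%:R * d) = phi (K%:R * d) + chord_slope K * d.
  by rewrite /chord_slope divfK ?gt_eqF//; ring.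
by rewrite /kink (E K.+1); ring.
Qed.

(** Past its node, the last line runs below the prolonged chord over [K d, (K + 1) d], and convexity
    keeps phi above that chord. Before the node the last hinge vanishes. *)
Lemma delayed_le K u : 0 <= u -> delayed K u <= phi u.
Proof.
move=> u0; elim: K => [|K IH]; first by rewrite /delayed big_ord0 phi_ge0.
have [uK|Ku] := leP u (K.+1%:R * d).
  rewrite /delayed big_ord_recr/= -/(delayed K u).
  have -> : Num.max (u - K.+1%:R * d) 0 = 0 by apply/max_idPr; rewrite subr_le0.
  by rewrite mulr0 addr0.
rewrite delayed_line; last exact: ltW.
have E n : n.+1%:R = n%:R + 1 :> R by rewrite -addn1 natrD.
have Kd0 : 0 <= K%:R * d by rewrite mulr_ge0 ?ler0n ?(ltW d0).
have sE : chord_slope K * d = phi (K.+1%:R * d) - phi (K%:R * d).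
  by rewrite /chord_slope divfK ?gt_eqF.
have s0 : 0 <= chord_slope K.
  by rewrite divr_ge0 ?(ltW d0)// subr_ge0 phi_mono// ler_pM2r// ler_nat.
have := @phi_chord (K%:R * d) (K.+1%:R * d) u Kd0.
rewrite ler_pM2r// ler_nat leqnSn (ltW Ku) => /(_ isT isT).
have KE : K.+1%:R * d = K%:R * d + d by rewrite E; ring.
rewrite KE in Ku sE *; move=> H.
have {}H : 0 <= phi u - phi (K%:R * d) - chord_slope K * (u - K%:R * d).
  rewrite -(pmulr_lge0 _ d0); have -> : (phi u - phi (K%:R * d) -
      chord_slope K * (u - K%:R * d)) * d = (phi u - phi (K%:R * d)) * d -
      (chord_slope K * d) * (u - K%:R * d) by ring.
  by rewrite sE; lra.
have : 0 <= chord_slope K * d by rewrite mulr_ge0// ltW.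
by lra.
Qed.

Lemma delayed_mono K L u : (K <= L)%N -> delayed K u <= delayed L u.
Proof.
move=> KL; rewrite /delayed -(subnKC KL) big_split_ord/= lerDl sumr_ge0// => i _.
by rewrite mulr_ge0 ?kink_ge0// le_max lexx orbT.
Qed.

(** The delay loses at most two mesh widths of the argument, and by convexity the slope of phi up to
    u is at most phi (u + 1) - phi u. *)
Lemma delayed_ge K u : 0 <= u -> u <= K%:R * d ->
  phi u - 2 * d * (phi (u + 1) - phi u) <= delayed K u.
Proof.
move=> u0 uK; have D0 : 0 <= phi (u + 1) - phi u by rewrite subr_ge0 phi_mono//; lra.
have E n : n.+1%:R = n%:R + 1 :> R by rewrite -addn1 natrD.
have := trunc_itv (_ : 0 <= u / d); rewrite divr_ge0 ?(ltW d0)// => /(_ isT).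
set j := Num.trunc _; rewrite ler_pdivlMr// ltr_pdivrMr// => /andP[ju uj].
(* y is the node (j - 1) d, where j d <= u < (j + 1) d, or 0 when j = 0. *)
have [y [y0 yu uy yd]] : exists y, [/\ 0 <= y, y <= u, u - y <= 2 * d & phi y <= delayed K u].
  case jE : j => [|j'].
    exists 0; split=> //; first by move: uj; rewrite jE mul1r; lra.
    have [_ -> _] := phi_orlicz; rewrite /delayed sumr_ge0// => i _.
    by rewrite mulr_ge0 ?kink_ge0// le_max lexx orbT.
  exists (j'%:R * d); rewrite mulr_ge0 ?ler0n ?(ltW d0)//; split=> //.
  - by apply: le_trans ju; rewrite ler_pM2r// ler_nat jE.
  - by move: uj; rewrite jE !E; lra.
  have jK : (j'.+1 <= K)%N.
    by rewrite -(ler_nat R) -jE -(ler_pM2r d0) (le_trans ju).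
  apply: le_trans (delayed_mono u jK).
  rewrite delayed_line -?jE// lerDl mulr_ge0// ?subr_ge0// divr_ge0 ?(ltW d0)//.
  by rewrite subr_ge0 phi_mono ?mulr_ge0 ?ler0n ?(ltW d0)// ler_pM2r// ler_nat.
have u1 : u <= u + 1 by lra.
have := phi_chord y0 yu u1; have := phi_mono u0 u1.
by nra.
Qed.

End linear_interpolation.

Local Notation mu := (@lebesgue_measure R).

(** Nothing is known of phi on negative numbers; this version is nondecreasing on the whole line,
    hence measurable. *)
Let phip (u : R) := phi (Num.max u 0).

Lemma measurable_er_map_phi (D : set R) (p : R -> \bar R) (w : R -> R) : measurable D ->
  measurable_fun D p -> measurable_fun D w -> (forall t, D t -> (0 <= p t)%E) ->
  (forall t, D t -> 0 < w t) ->
  measurable_fun D (fun t => er_map phi (p t / (w t)%:E) * (w t)%:E)%E.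
Proof.
move=> mD mp mw p0 w0.
have E t : D t -> er_map phi (p t / (w t)%:E)%E = er_map phip (p t * ((w t)^-1)%:E)%E.
  move=> Dt; rewrite inver gt_eqF ?w0//; have := p0 t Dt; case: (p t) => [r| |]//.
    rewrite lee_fin => r0; rewrite /= /phip; congr (phi _)%:E.
    by apply/esym/max_idPl; rewrite divr_ge0// ltW// w0.
  by move=> _; rewrite mulyr gtr0_sg ?invr_gt0 ?w0// mul1e.
apply: emeasurable_funM; last exact/measurable_EFinP.
apply: (@eq_measurable_fun _ _ _ _ _ (fun t => er_map phip (p t * ((w t)^-1)%:E)%E)).
  by move=> t /set_mem/E ->.
have mphip : measurable_fun [set: R] phip.
  apply: nondecreasing_measurable => // x y xy; apply: phi_mono.
    by rewrite le_max lexx orbT.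
  by rewrite ge_max !le_max xy lexx orbT.
apply: (measurableT_comp (f := er_map phip)).
  exact: (@measurable_er_map _ (measurableTypeR R)).
apply: emeasurable_funM => //; apply/measurable_EFinP.
apply: (@eq_measurable_fun _ _ _ _ _ (fun t => (w t) `^ (-1))).
  by move=> t /set_mem Dt; rewrite powR_inv1// ltW// w0.
exact: (@measurableT_comp _ _ _ _ _ _ (@powR R ^~ (-1))).
Qed.

(** The form of [delayed d K (p / w) * w] with the weight moved into the hinges, which become (p - s
    w)_+; it also makes sense where p = +oo. *)
Definition delayed_integrand (d : R) (K : nat) (p : R -> \bar R) (w : R -> R) (t : R) : \bar R :=
  (\sum_(k < K) (kink d k)%:E * maxe (p t - (k.+1%:R * d * w t)%:E) 0)%E.

Lemma delayed_integrandE d K (p : R -> R) w t : 0 < w t ->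
  delayed_integrand d K (EFin \o p) w t = (delayed d K (p t / w t) * w t)%:E.
Proof.
move=> w0; rewrite /delayed_integrand /delayed mulr_suml -sumEFin; apply: eq_bigr => k _.
rewrite -EFinB -EFin_max -EFinM -[in RHS]mulrA maxr_pMl ?(ltW w0)//.
by rewrite mul0r [in RHS](mulrBl (w t)) divfK ?gt_eqF.
Qed.

Lemma delayed_integrand_ge0 d K p w t : 0 < d -> (0 <= delayed_integrand d K p w t)%E.
Proof.
move=> d0; apply: sume_ge0 => k _; apply: mule_ge0; first by rewrite lee_fin kink_ge0.
by rewrite le_max lexx orbT.
Qed.

Lemma delayed_integrand_le d K (p : R -> \bar R) w t : 0 < d -> (0 <= p t)%E -> 0 < w t ->
  (delayed_integrand d K p w t <= er_map phi (p t / (w t)%:E) * (w t)%:E)%E.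
Proof.
move=> d0; case pt: (p t) => [r| |]// r0 w0.
  have -> : delayed_integrand d K p w t = delayed_integrand d K (EFin \o (fun=> r)) w t.
    by apply: eq_bigr => k _; rewrite pt.
  rewrite delayed_integrandE// inver gt_eqF//= -EFinM lee_fin ler_pM2r//.
  by rewrite delayed_le// divr_ge0// ltW.
by rewrite inver gt_eqF// mulyr gtr0_sg ?invr_gt0// mul1e/= gt0_mulye ?lte_fin// leey.
Qed.

Lemma measurable_excess_part (D : set R) (p : R -> \bar R) (w : R -> R) s :
  measurable_fun D p -> measurable_fun D w ->
  measurable_fun D (fun t => maxe (p t - (s * w t)%:E) 0)%E.
Proof.
move=> mp mw; apply: measurable_maxe => //; apply: emeasurable_funB => //.
by apply/measurable_EFinP; exact: measurable_funM.
Qed.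

(** For the delayed interpolations the claim is a finite sum of hinge inequalities. On the right
    they stay below phi, on the left they converge to it. *)
Lemma orlicz_integral_le (D : set R) (p1 w1 w2 : R -> R) (p2 : R -> \bar R) :
  measurable D -> measurable_fun D p1 -> measurable_fun D p2 ->
  measurable_fun D w1 -> measurable_fun D w2 ->
  (forall t, D t -> 0 <= p1 t) -> (forall t, D t -> (0 <= p2 t)%E) ->
  (forall t, D t -> 0 < w1 t) -> (forall t, D t -> 0 < w2 t) ->
  (forall s, 0 < s -> (\int[mu]_(t in D) maxe ((p1 t)%:E - (s * w1 t)%:E) 0 <=
                       \int[mu]_(t in D) maxe (p2 t - (s * w2 t)%:E) 0)%E) ->
  (\int[mu]_(t in D) (er_map phi ((p1 t)%:E / (w1 t)%:E) * (w1 t)%:E) <=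
   \int[mu]_(t in D) (er_map phi (p2 t / (w2 t)%:E) * (w2 t)%:E))%E.
Proof.
move=> mD mp1 mp2 mw1 mw2 p10 p20 w10 w20 H.
(* The mesh tends to 0 while the range [K n * d n] = n + 1 of the grid tends to infinity. *)
pose d n : R := n.+1%:R^-1; pose K n := (n.+1 * n.+1)%N.
have d0 n : 0 < d n by rewrite invr_gt0 ltr0n.
have mE p w n : measurable_fun D p -> measurable_fun D w ->
    measurable_fun D (delayed_integrand (d n) (K n) p w).
  move=> mp mw; apply: emeasurable_sum => k; apply: emeasurable_funM; first exact: measurable_cst.
  exact: measurable_excess_part.
have step n : (\int[mu]_(t in D) delayed_integrand (d n) (K n) (EFin \o p1) w1 t <=
    \int[mu]_(t in D) delayed_integrand (d n) (K n) p2 w2 t)%E.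
  have E p w : measurable_fun D p -> measurable_fun D w ->
    (\int[mu]_(t in D) delayed_integrand (d n) (K n) p w t = \sum_(k < K n) (kink (d n) k)%:E *
      \int[mu]_(t in D) maxe (p t - (k.+1%:R * d n * w t)%:E) 0)%E.
    move=> mp mw; rewrite ge0_integral_sum//.
    - apply: eq_bigr => k _; rewrite ge0_integralZl_EFin//.
      + by move=> t _; rewrite le_max lexx orbT.
      + exact: measurable_excess_part.
      + exact: kink_ge0.
    - move=> k; apply: emeasurable_funM; first exact: measurable_cst.
      exact: measurable_excess_part.
    - move=> k t _; apply: mule_ge0; first by rewrite lee_fin kink_ge0.
      by rewrite le_max lexx orbT.
  rewrite !E//; last exact/measurable_EFinP.
  apply: lee_sum => k _; apply: lee_wpmul2l; first by rewrite lee_fin kink_ge0.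
  (* Owing to the delay every hinge sits at a positive multiple of d, as [H] requires. *)
  by apply: H; rewrite mulr_gt0// ltr0n.
set M := (X in (_ <= X)%E).
have bound n : (\int[mu]_(t in D) delayed_integrand (d n) (K n) (EFin \o p1) w1 t <= M)%E.
  apply: le_trans (step n) _; apply: ge0_le_integral => //.
  - by move=> t _; exact: delayed_integrand_ge0.
  - exact: mE.
  - exact: measurable_er_map_phi.
  - by move=> t Dt; apply: delayed_integrand_le => //; [exact: p20|exact: w20].
have mp1' : measurable_fun D (EFin \o p1) by exact/measurable_EFinP.
(* The grids are not nested, so convergence need not be monotone; Fatou's lemma suffices since M
   bounds every term. *)
have := fatou mu mD (fun n => mE _ _ n mp1' mw1)
  (fun n t _ => @delayed_integrand_ge0 (d n) (K n) (EFin \o p1) w1 t (d0 n)).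
rewrite (@eq_lebesgue_integral _ D (fun t => limn_einf (fun n =>
    delayed_integrand (d n) (K n) (EFin \o p1) w1 t))
  (fun t => er_map phi ((p1 t)%:E / (w1 t)%:E) * (w1 t)%:E)%E).
  move/le_trans; apply; rewrite limn_einf_lim; apply: lime_le; first exact: is_cvg_einfs.
  apply: nearW => n; apply: le_trans (bound n).
  by apply: ereal_inf_lbound; exists n => /=.
move=> t Dt.
have wt := w10 t Dt; have pt := p10 t Dt.
set u := p1 t / w1 t; have u0 : 0 <= u by rewrite divr_ge0// ltW.
have cv : delayed (d n) (K n) u @[n --> \oo] --> phi u.
  apply: (@squeeze_cvgr _ _ _ _ (fun n => phi u - 2 * d n * (phi (u + 1) - phi u)) (fun=> phi u)).
  - near=> n; apply/andP; split; last exact: delayed_le.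
    apply: delayed_ge => //; rewrite /K natrM -mulrA divff ?mulr1; last by rewrite pnatr_eq0.
    apply: (le_trans (ltW (archi_boundP u0))); rewrite ler_nat ltnW// ltnS.
    by near: n; exact: nbhs_infty_ge.
  - rewrite -[X in _ --> X]subr0; apply: cvgB; first exact: cvg_cst.
    rewrite -[X in _ --> X](mul0r (phi (u + 1) - phi u)); apply: cvgM; last exact: cvg_cst.
    rewrite -[X in _ --> X](mulr0 2); apply: cvgM; first exact: cvg_cst.
    exact: cvg_harmonic.
  - exact: cvg_cst.
rewrite inver gt_eqF//= -EFinM.
apply: (cvg_limn_einf_sup _).1.
under eq_cvg do rewrite delayed_integrandE//.
apply: cvg_EFin; first exact: nearW.
by apply: cvgM => //; exact: cvg_cst.
Unshelve. all: by end_near. Qed.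

End convex_majorization.

(** * The optimal weight *)

Section level_function_theory.
Variables (R : realType) (a : \bar R) (k w : R -> R) (A B : R).
Local Notation mu := (@lebesgue_measure R).
Hypothesis kP : decreasing_on a k.
Hypothesis wP : decreasing_on a w.
Hypothesis w_gt0 : forall t, oint 0 a t -> 0 < w t.
(** Right-continuity of f^*, reduced to the one inequality that monotonicity does not give. *)
Hypothesis k_rc : forall t c, oint 0 a t ->
  (forall y, t < y -> oint 0 a y -> k y <= c) -> k t <= c.
Hypothesis FAB : forall y, dom a y -> prim a k y <= A * prim a w y + B.
Local Notation F := (prim a k).
Local Notation W := (prim a w).

Lemma primitive_pair_prim : primitive_pair a F W A B.
Proof.
split=> //; rewrite ?prim0//; try exact: prim_continuous.
  by move=> x y; exact: prim_mono.
move=> x y x0 xy dy; have [z [xz zy zm]] : exists z, [/\ x < z, z < y & oint 0 a z].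
  have Im : oint 0 a ((x + y) / 2) by apply: dom_oint dy; lra.
  by exists ((x + y) / 2); split=> //; lra.
have dz := oint_dom zm.
have h1 := prim_ge wP x0 (ltW xz) zm.
have h2 : W z <= W y by apply: prim_mono => //; [lra|exact: ltW].
have := w_gt0 zm; nra.
Qed.
Let PP := primitive_pair_prim.

Local Notation slope := (slope a F W).
Local Notation lo := (lo a F W).
Local Notation hi := (hi a F W).
Local Notation plateau := (plateau a F W).

Definition inner (t : R) : Prop := oint (lo (slope t))%:E (hi (slope t)) t.

Lemma plateau_slope t : oint 0 a t -> plateau (slope t) t.
Proof. by []. Qed.

Lemma outer_argmax t : oint 0 a t -> ~ inner t -> is_argmax a F W (slope t) t.
Proof.
move=> It nin; have pt := plateau_slope It.
have := lo_le pt; rewrite le_eqVlt => /predU1P[lot|lot].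
  by rewrite -[X in is_argmax _ _ _ _ X]lot; exact: (lo_argmax PP pt).
have := hi_ge pt; rewrite le_eqVlt => /predU1P[hit|hit].
  by apply: (hi_argmax PP pt); rewrite hit.
by exfalso; apply: nin; apply/andP; rewrite lte_fin.
Qed.

(** The excess is maximal at t, so F grows from t to y by at most slope t times the growth of W;
    monotonicity of k and w bounds both increments. [outer_ge] is the same to the left of t. *)
Lemma outer_le t y : oint 0 a t -> ~ inner t -> oint 0 a y -> t < y -> k y <= slope t * w t.
Proof.
move=> It nin Iy ty; have t0 := oint_gt0 It.
have [_ am] := outer_argmax It nin; have := am y (oint_dom Iy); rewrite /excess.
have := prim_ge kP (ltW t0) (ltW ty) Iy.
have := prim_le wP It (ltW ty) (oint_dom Iy).
have := slope_ge0 PP It => s0 h1 h2 h3.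
rewrite -(ler_pM2r (_ : 0 < y - t)); last by rewrite subr_gt0.
by nra.
Qed.

Lemma outer_ge t x : oint 0 a t -> ~ inner t -> 0 < x -> x < t -> slope t * w t <= k x.
Proof.
move=> It nin x0 xt; have Ix := oint_lt x0 (ltW xt) It.
have [_ am] := outer_argmax It nin; have := am x (oint_dom Ix); rewrite /excess.
have := prim_ge wP (ltW x0) (ltW xt) It.
have := prim_le kP Ix (ltW xt) (oint_dom It).
have := slope_ge0 PP It => s0 h1 h2 h3.
rewrite -(ler_pM2r (_ : 0 < t - x)); last by rewrite subr_gt0.
by nra.
Qed.

(* Points outside the level intervals where f^* is not left-continuous; there
   f^0 = f^* may drop below [slope * w]. *)
Definition jumps : set R := [set t | [/\ oint 0 a t, ~ inner t & k t < slope t * w t]].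

(** By [outer_ge] the gaps between k and slope * w at different jumps are disjoint. *)
Lemma countable_jumps : countable jumps.
Proof.
apply: (@rational_between _ (EFin \o k) (fun t => (slope t * w t)%:E)) => [t []|t []|s t] /=.
- by move=> It _ _; rewrite lee_fin; exact: dec_ge0 kP _ It.
- by move=> _ _; rewrite lte_fin.
- by move=> [Is _ _] [It nin _] st; rewrite lee_fin; apply: outer_ge => //; exact: oint_gt0 Is.
Qed.

Lemma outer_eq t : oint 0 a t -> ~ inner t -> ~ jumps t -> k t = slope t * w t.
Proof.
move=> It nin nj; apply/eqP; rewrite eq_le; apply/andP; split.
  by apply: k_rc => // y ty Iy; exact: outer_le.
by rewrite leNgt; apply/negP => lt; apply: nj.
Qed.

Section inner_points.
Variable t : R.
Hypothesis It : oint 0 a t.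
Hypothesis it : inner t.

Let lot : lo (slope t) < t. Proof. by case/andP: it; rewrite lte_fin. Qed.

(** If k t = 0, then F is flat after t, but a later plateau point is late for half the slope, so
    some later excess reaches that at t. *)
Lemma inner_gt0 : 0 < slope t -> 0 < k t.
Proof.
move=> c0; rewrite lt_neqAle (dec_ge0 kP It) andbT; apply/eqP => k0.
have /andP[_ thi] := it; have [u [tu _ uh]] := between_ereal thi ltr01.
have Iu : oint 0 a u.
  apply/andP; rewrite lte_fin (lt_trans (oint_gt0 It) tu); split=> //.
  exact: lt_le_trans uh (hi_le _ _ _ _).
have pu : plateau (slope t) u.
  by apply: (plateau_itv PP); apply/andP; rewrite lte_fin (lt_trans lot).
have c2 : 0 <= slope t / 2 by lra.
have c3 : slope t / 2 < slope u by rewrite pu.2; lra.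
have [|y [dy uy]] := (late_lt PP Iu c2 c3).2 t; first by rewrite ltW ?(oint_gt0 It)//= ltW.
have ty : t <= y by lra.
have := prim_le kP It ty dy; rewrite -k0 mul0r.
have : W t < W y by apply: (pair_Wlt PP) => //; [exact: ltW (oint_gt0 It)|lra].
by rewrite /excess; nra.
Qed.

(** Compares average growths of F and W over (lo, t), using maximality at [lo]. With the mirror
    statement [inner_ge] at [hi], it makes the optimal weight decrease across the ends of
    plateaus. *)
Lemma inner_le s : oint 0 a s -> s <= lo (slope t) -> k t <= slope t * w s.
Proof.
move=> Is sl; have pt := plateau_slope It.
have [dl am] := lo_argmax PP pt; have := am t (oint_dom It); rewrite /excess.
have lo0 := lo_ge0 pt.
have := prim_ge kP lo0 (ltW lot) It.
have s0 := oint_gt0 Is.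
have Il : oint 0 a (lo (slope t)) by apply: oint_lt (ltW lot) It; lra.
have := prim_le wP Il (ltW lot) (oint_dom It).
have := dec_le wP Is Il sl.
have := slope_ge0 PP It => c0 h1 h2 h3 h4.
rewrite -(ler_pM2r (_ : 0 < t - lo (slope t))); last by rewrite subr_gt0.
have h5 := ler_wpM2l c0 h2; have h6 := ler_wpM2l c0 h1.
have : slope t * w (lo (slope t)) * (t - lo (slope t)) <= slope t * w s * (t - lo (slope t)).
  by rewrite ler_pM2r ?subr_gt0.
by lra.
Qed.

Lemma inner_ge s : oint 0 a s -> (hi (slope t) <= s%:E)%E -> slope t * w s <= k t.
Proof.
move=> Is hs; have pt := plateau_slope It.
have [b hb] : exists b, hi (slope t) = b%:E.
  move: hs; have := hi_ge pt; case: (hi _) => [b| |]//; first by exists b.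
move: hs; rewrite hb lee_fin => bs.
have [db am] := hi_argmax PP pt hb; have := am t (oint_dom It); rewrite /excess.
have tb : t < b by have /andP[_] := it; rewrite hb lte_fin.
have t0 := oint_gt0 It.
have Ib : oint 0 a b by apply: oint_lt bs Is; lra.
have := prim_le kP It (ltW tb) db.
have := prim_ge wP (ltW t0) (ltW tb) Ib.
have := dec_le wP Ib Is bs.
have := slope_ge0 PP It => c0 h1 h2 h3 h4.
rewrite -(ler_pM2r (_ : 0 < b - t)); last by rewrite subr_gt0.
have h5 := ler_wpM2l c0 h2; have h6 := ler_wpM2l c0 h1.
have : slope t * w s * (b - t) <= slope t * w b * (b - t) by rewrite ler_pM2r ?subr_gt0.
by lra.
Qed.

End inner_points.

(* The weight w f^* / f^0.  Where f^* = f^0 only up to [jumps], the value [w]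
   makes it decreasing and positive everywhere. *)
Definition optimal_weight (t : R) : R :=
  if `[< inner t /\ 0 < slope t >] then k t / slope t else w t.
Local Notation v := optimal_weight.

Lemma optimal_weight_gt0 t : oint 0 a t -> 0 < v t.
Proof.
move=> It; rewrite /optimal_weight; case: asboolP => [[it c0]|_]; last exact: w_gt0.
by rewrite divr_gt0 ?inner_gt0.
Qed.

Lemma optimal_weight_le s t : oint 0 a s -> oint 0 a t -> s <= t -> v t <= v s.
Proof.
move=> Is It st; have sl := slope_le PP Is It st.
rewrite /optimal_weight; case: asboolP => [[it c0]|nt]; case: asboolP => [[os d0]|ns].
- have [E|ne] := eqVneq (slope s) (slope t).
    by rewrite E ler_pM2r ?invr_gt0//; exact: (dec_le kP).
  have lt : slope t < slope s by rewrite lt_neqAle eq_sym ne.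
  have sl' : s <= lo (slope t).
    rewrite leNgt; apply/negP => ls; move/eqP: ne; apply.
    have : plateau (slope t) s; last by case.
    apply: (plateau_itv PP); apply/andP; rewrite lte_fin; split=> //.
    by apply: le_lt_trans (_ : (t%:E < _)%E); [rewrite lee_fin|case/andP: it].
  have hl : (hi (slope s) <= (lo (slope t))%:E)%E.
    apply: ge_ereal_sup => _ [u [Iu us] <-]; rewrite lee_fin.
    apply: lb_le_inf; first by exists t.
    move=> z [Iz zt]; rewrite leNgt; apply/negP => zu.
    by have := slope_le PP Iz Iu (ltW zu); rewrite us zt leNgt lt.
  have Il : oint 0 a (lo (slope t)).
    apply: (oint_lt _ _ It); first by apply: lt_le_trans sl'; exact: oint_gt0 Is.
    by apply: lo_le; exact: plateau_slope.
  (* On two distinct plateaus the value of w at [lo (slope t)] separates v t from v s. *)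
  rewrite ler_pdivrMr// (le_trans (inner_le It it Il (lexx _)))// mulrC ler_pM2r//.
  by rewrite ler_pdivlMr// mulrC; exact: inner_ge.
- rewrite ler_pdivrMr//; rewrite mulrC; apply: inner_le => //.
  rewrite leNgt; apply/negP => ls.
  have ps : plateau (slope t) s.
    apply: (plateau_itv PP); apply/andP; rewrite lte_fin; split=> //.
    by apply: le_lt_trans (_ : (t%:E < _)%E); [rewrite lee_fin|case/andP: it].
  apply: ns; rewrite /inner ps.2; split=> //; apply/andP; rewrite lte_fin; split=> //.
  by apply: le_lt_trans (_ : (t%:E < _)%E); [rewrite lee_fin|case/andP: it].
- rewrite ler_pdivlMr// mulrC; apply: inner_ge => //.
  rewrite leNgt; apply/negP => th.
  have pt : plateau (slope s) t.
    apply: (plateau_itv PP); apply/andP; rewrite lte_fin; split=> //.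
    by apply: lt_le_trans st; case/andP: os; rewrite lte_fin.
  apply: nt; rewrite /inner pt.2; split=> //; apply/andP; rewrite lte_fin; split=> //.
  by apply: lt_le_trans st; case/andP: os; rewrite lte_fin.
- exact: (dec_le wP).
Qed.

Lemma slope_optimal_weight t : oint 0 a t -> ~ jumps t -> k t = slope t * v t.
Proof.
move=> It nj; rewrite /optimal_weight; case: asboolP => [[it c0]|no].
  by rewrite mulrC divfK// gt_eqF.
have [it|nin] := pselect (inner t); last exact: outer_eq.
(* On the plateau of value 0 the weight is w; F is maximal at its left end, so k vanishes at t. *)
have c0 : slope t = 0.
  apply/eqP; rewrite eq_le (slope_ge0 PP It) andbT leNgt; apply/negP => c0.
  by apply: no.
have pt := plateau_slope It; have [dl am] := lo_argmax PP pt.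
have lot : lo (slope t) < t by case/andP: it; rewrite lte_fin.
have := am t (oint_dom It); rewrite /excess c0 !mul0r !subr0 -c0.
have := prim_ge kP (lo_ge0 pt) (ltW lot) It.
have := dec_ge0 kP It; nra.
Qed.

(** * Comparison of integrals plateau by plateau *)

Lemma measurable_slope (D : set R) : measurable D -> D `<=` oint 0 a -> measurable_fun D slope.
Proof.
move=> mD Da; apply/measurable_EFinP.
apply: (@measurable_funS _ _ _ _ (oint 0 a)) => //; first exact: measurable_oint.
apply: nonincreasing_in_measurable; first exact: is_interval_oint.
by move=> s t Is It st; rewrite lee_fin; exact: (slope_le PP).
Qed.

Lemma measurable_weight (D : set R) : measurable D -> D `<=` oint 0 a -> measurable_fun D w.
Proof. by move=> mD Da; apply/measurable_EFinP; exact: (measurable_decr wP). Qed.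

Lemma measurable_optimal_weight (D : set R) : measurable D -> D `<=` oint 0 a ->
  measurable_fun D v.
Proof.
move=> mD Da; apply/measurable_EFinP.
apply: (@measurable_funS _ _ _ _ (oint 0 a)) => //; first exact: measurable_oint.
apply: nonincreasing_in_measurable; first exact: is_interval_oint.
by move=> s t Is It st; rewrite lee_fin; exact: optimal_weight_le.
Qed.

Lemma sub_itv_oint x : dom a x -> `]0, x[%classic `<=` oint 0 a.
Proof. by move=> dx t /=; rewrite in_itv/= => /andP[t0 tx]; exact: dom_oint dx. Qed.

Lemma measurable_piece x c : dom a x -> measurable (`]0, x[ `&` [set t | slope t = c]).
Proof.
move=> dx; apply: is_interval_measurable => s t /=; rewrite !in_itv/=.
move=> [/andP[s0 sx] sc] [/andP[t0 tx] tc] u /andP[su ut].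
have u0 : 0 < u by exact: lt_le_trans su.
have ux : u < x by exact: le_lt_trans tx.
split; first by rewrite in_itv/= u0.
have [Is It Iu] : [/\ oint 0 a s, oint 0 a t & oint 0 a u].
  by split; apply: sub_itv_oint dx _ _; rewrite /= in_itv/= ?s0 ?t0 ?u0.
by apply/eqP; rewrite eq_le -{1}sc -{1}tc !(slope_le PP).
Qed.

(** The point q is min (hi c, x): cutting at x shortens at most one plateau, and an uncut one ends
    at a maximiser. *)
Lemma pieceP x c t : dom a x -> 0 < t -> t < x -> slope t = c -> exists q,
  [/\ [/\ lo c <= q, dom a q & (q%:E <= hi c)%E], (q < x -> hi c = q%:E),
      `]lo c, q[ `<=` `]0, x[ `&` [set t | slope t = c] &
      `]0, x[ `&` [set t | slope t = c] `<=` `[lo c, q]].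
Proof.
move=> dx t0 tx tc; have It : oint 0 a t by exact: dom_oint dx.
have pt : plateau c t by [].
have [q qE] : exists q : R, q%:E = mine (hi c) x%:E.
  have := hi_ge pt; case: (hi c) => [h| |]// _.
    by exists (Num.min h x); rewrite EFin_min.
  by exists x; rewrite minEle leye_eq.
have lot := lo_le pt; have lo0 := lo_ge0 pt.
have tq : t <= q by rewrite -lee_fin qE le_min hi_ge// lee_fin ltW.
have qx : q <= x by rewrite -lee_fin qE ge_min lexx orbT.
have qh : (q%:E <= hi c)%E by rewrite qE ge_min lexx.
exists q; split.
- by split=> //; [lra|apply: dom_le dx => //; lra].
- move=> qx'; move: qE; rewrite minEle; case: ifP => _ qE; first by rewrite qE.
  by case: qE => qE; move: qx'; rewrite qE ltxx.
- move=> u /=; rewrite in_itv/= => /andP[lu uq].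
  have [Iu uc] : plateau c u.
    by apply: (plateau_itv PP); apply/andP; rewrite lte_fin lu; split=> //; apply: lt_le_trans qh.
  by split=> //; rewrite in_itv/=; apply/andP; split; lra.
- move=> u /= [ux uc]; have pu : plateau c u by split=> //; apply: (sub_itv_oint dx).
  rewrite in_itv/= lo_le//= -lee_fin qE le_min hi_ge//= lee_fin.
  by move: ux; rewrite in_itv/= => /andP[_ /ltW].
Qed.

Lemma integral_open_kernel (S : set R) (p q : R) (h : R -> \bar R) : measurable S ->
  measurable_fun S h -> (forall t, S t -> (0 <= h t)%E) ->
  `]p, q[ `<=` S -> S `<=` `[p, q] -> (\int[mu]_(t in S) h t = \int[mu]_(t in `]p, q[) h t)%E.
Proof.
move=> mS mh h0 sS Ss; pose N : set R := [set p; q].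
have mN : measurable N by apply: measurableU; exact: measurable_set1.
have N0 : mu N = 0%E.
  apply: countable_lebesgue_measure0.
  by apply: countable_setU; apply: finite_set_countable; exact: finite_set1.
have -> : (\int[mu]_(t in S) h t = \int[mu]_(t in S `\` N) h t)%E.
  exact: ge0_negligible_integral.
congr (integral _ _ _); apply/seteqP; split=> t.
  move=> [/Ss /=]; rewrite !in_itv/= => /andP[pt tq] /not_orP[tp tq'].
  by rewrite !lt_neqAle pt tq !andbT; apply/andP; split; apply/eqP => // e; apply: tp.
move=> tpq; split; first exact: sS.
by move: tpq; rewrite /= in_itv/= => /andP[pt tq] [/= e|/= e]; move: pt tq; rewrite e ltxx.
Qed.

(** Common frame of the three comparisons below: pointwise at outer points, by increments of F and W
    on the pieces ]lo c, q[. *)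
Lemma le_integral_slope x (h1 h2 : R -> \bar R) : dom a x ->
  measurable_fun `]0, x[ h1 -> measurable_fun `]0, x[ h2 ->
  (forall t, 0 < t -> t < x -> (0 <= h1 t)%E) -> (forall t, 0 < t -> t < x -> (0 <= h2 t)%E) ->
  (forall t, 0 < t -> t < x -> ~ inner t -> ~ jumps t -> (h1 t <= h2 t)%E) ->
  (forall c q, 0 <= c -> lo c < q -> is_argmax a F W c (lo c) -> dom a q -> (q%:E <= hi c)%E ->
     q <= x -> (q < x -> is_argmax a F W c q) ->
     (forall t, lo c < t -> t < q -> [/\ oint 0 a t, slope t = c & inner t]) ->
     (\int[mu]_(t in `]lo c, q[) h1 t <= \int[mu]_(t in `]lo c, q[) h2 t)%E) ->
  (\int[mu]_(t in `]0%R, x[) h1 t <= \int[mu]_(t in `]0%R, x[) h2 t)%E.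
Proof.
move=> dx m1 m2 h10 h20 Hout Hin.
have itvP t : `]0, x[%classic t -> 0 < t /\ t < x by rewrite /= in_itv/= => /andP.
apply: (@le_integral_plateaus _ _ slope _ _ jumps) => //.
- by move=> t /itvP[]; exact: h10.
- by move=> t /itvP[]; exact: h20.
- exact: countable_jumps.
- by move=> c; exact: measurable_piece.
- move=> c; set S := _ `&` _.
  have [->|/set0P[t [/itvP[t0 tx] tc]]] := eqVneq S set0; first by rewrite !integral_set0.
  have [q [[lq dq qh] qx s1 s2]] := pieceP dx t0 tx tc.
  have mS : measurable S by exact: measurable_piece.
  have SI : S `<=` `]0, x[ by move=> u [].
  have IE h : measurable_fun `]0, x[ h -> (forall t, 0 < t -> t < x -> (0 <= h t)%E) ->
      (\int[mu]_(t in S) h t = \int[mu]_(t in `]lo c, q[) h t)%E.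
    move=> mh h0; apply: integral_open_kernel => //; first exact: measurable_funS SI mh.
    by move=> u /SI/itvP[]; exact: h0.
  rewrite (IE h1)// (IE h2)//.
  move: lq; rewrite le_eqVlt => /predU1P[->|lq]; first by rewrite set_itvoo0 !integral_set0.
  have pt : plateau c t by split=> //; exact: dom_oint dx.
  have c0 : 0 <= c by rewrite -tc; apply: (slope_ge0 PP); case: pt.
  have qlex : q <= x.
    have [//|xq] := leP q x; exfalso.
    have : `]lo c, q[%classic ((Num.max x (lo c) + q) / 2).
      rewrite /= in_itv/=; have : Num.max x (lo c) < q by rewrite gt_max xq.
      have : lo c <= Num.max x (lo c) by rewrite le_max lexx orbT.
      by move=> *; apply/andP; split; lra.
    move/s1/SI/itvP => [_].
    have : x <= Num.max x (lo c) by rewrite le_max lexx.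
    by move=> *; lra.
  apply: Hin => //.
  + exact: (lo_argmax PP pt).
  + by move=> /qx hq; exact: (hi_argmax PP pt).
  + move=> u lu uq; have [] : S u by apply: s1; rewrite /= in_itv/= lu.
    move=> uI uc; split=> //; first exact: (sub_itv_oint dx).
    rewrite /inner uc; apply/andP; rewrite lte_fin; split=> //.
    by apply: lt_le_trans qh; rewrite lte_fin.
- move=> t /itvP[t0 tx] nj H; apply: Hout => // it.
  have /andP[] := it; rewrite lte_fin => lot /between_ereal/(_ ltr01)[u [tu _ uh]].
  (* The plateau of an inner point contains a rational, so t is already covered by the pieces. *)
  have /rat_in_itvoo[q] : t < u by [].
  rewrite in_itv/= => /andP[tq qu]; apply: (H q).
  have [_ ->] // : plateau (slope t) (ratr q).
  apply: (plateau_itv PP); apply/andP; rewrite lte_fin (lt_trans lot)//; split=> //.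
  by apply: lt_trans uh; rewrite lte_fin.
Qed.

Lemma integral_itv_slope (h : R -> R) c q : 0 <= c -> 0 <= lo c -> lo c <= q -> dom a q ->
  (forall t, lo c < t -> t < q -> h t = c * w t) ->
  (\int[mu]_(t in `]lo c, q[) (h t)%:E = (c * (W q - W (lo c)))%:E)%E.
Proof.
move=> c0 l0 lq dq hE.
rewrite (@eq_lebesgue_integral _ _ _ (fun t => c%:E * (w t)%:E)%E); last first.
  by move=> t; rewrite /= in_itv/= => /andP[lt tq]; rewrite hE// EFinM.
have sub t : `]lo c, q[%classic t -> oint 0 a t.
  rewrite /= in_itv/= => /andP[lt tq]; apply: dom_oint dq => //; exact: le_lt_trans lt.
rewrite ge0_integralZl_EFin//.
- by rewrite (prim_integral wP).
- by move=> t /sub/w_gt0/ltW; rewrite lee_fin.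
- exact: (measurable_itv_k wP).
Qed.

Lemma measurable_slope_weight (D : set R) : measurable D -> D `<=` oint 0 a ->
  measurable_fun D (fun t => (slope t * w t)%:E).
Proof.
move=> mD Da; apply/measurable_EFinP; apply: measurable_funM.
  exact: measurable_slope.
exact: measurable_weight.
Qed.

Lemma le_integral_level x : dom a x ->
  (\int[mu]_(t in `]0%R, x[) (k t)%:E <= \int[mu]_(t in `]0%R, x[) (slope t * w t)%:E)%E.
Proof.
move=> dx; have sx := sub_itv_oint dx.
have Ix t : 0 < t -> t < x -> oint 0 a t by move=> t0 tx; apply: sx; rewrite /= in_itv/= t0.
apply: le_integral_slope => //.
- by apply: (measurable_decr kP).
- exact: measurable_slope_weight.
- by move=> t t0 /(Ix _ t0) It; rewrite lee_fin (dec_ge0 kP).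
- move=> t t0 /(Ix _ t0) It; rewrite lee_fin mulr_ge0 ?(slope_ge0 PP)//.
  exact/ltW/w_gt0.
- by move=> t t0 /(Ix _ t0) It nit nj; rewrite lee_fin (outer_eq It).
move=> c q c0 lq [[l0 _] am] dq qh _ _ inn.
rewrite (prim_integral kP l0 (ltW lq) dq)
  (@integral_itv_slope (fun t => slope t * w t) c q c0 l0 (ltW lq) dq).
  by rewrite lee_fin; have := am q dq; rewrite /excess; lra.
by move=> t lt tq; have [_ -> _] := inn t lt tq.
Qed.

(** At x = lo c no plateau is cut, so every piece ends at a maximiser and the inequality of
    [le_integral_level] reverses. *)
Lemma ge_integral_level c t : plateau c t ->
  (\int[mu]_(t in `]0%R, lo c[) (slope t * w t)%:E <= (F (lo c))%:E)%E.
Proof.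
move=> pt; have [dl _] := lo_argmax PP pt.
have sx := sub_itv_oint dl; have l0 := lo_ge0 pt.
have Ix u : 0 < u -> u < lo c -> oint 0 a u by move=> u0 ul; apply: sx; rewrite /= in_itv/= u0.
have -> : (F (lo c))%:E = (\int[mu]_(t in `]0%R, lo c[) (k t)%:E)%E.
  by rewrite (prim_integral kP)// prim0 subr0.
apply: le_integral_slope => //.
- exact: measurable_slope_weight.
- by apply: (measurable_decr kP).
- move=> u u0 /(Ix _ u0) Iu; rewrite lee_fin mulr_ge0 ?(slope_ge0 PP)//.
  exact/ltW/w_gt0.
- by move=> u u0 /(Ix _ u0) Iu; rewrite lee_fin (dec_ge0 kP).
- by move=> u u0 /(Ix _ u0) Iu nit nj; rewrite lee_fin (outer_eq Iu).
move=> d q d0 lq [[l0' _] am] dq qh ql Hq inn.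
have [_ amq] : is_argmax a F W d q.
  (* If q = lo c, a point of the plateau of d beyond q would, by monotonicity of the slope, force d
     = c, although that plateau has points before lo c. *)
  have [/Hq//|lq'] := ltP q (lo c); have E : lo c = q by apply/eqP; rewrite eq_le lq'.
  have [z [lz zq]] : exists z, lo d < z /\ z < q by exists ((lo d + q) / 2); split; lra.
  have [Iz zd _] := inn z lz zq; have pz : plateau d z by [].
  apply: (hi_argmax PP pz); apply/eqP; rewrite eq_le qh andbT.
  apply: ge_ereal_sup => _ [u [Iu ud] <-]; rewrite lee_fin -E leNgt; apply/negP => lu.
  have [y [Iy yc] yu] : exists2 y, plateau c y & y < u by apply: inf_lt => //; exists t.
  have ly : lo c <= y by exact: lo_le.
  have zy : z <= y by rewrite (le_trans _ ly)// E ltW.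
  have h1 := slope_le PP Iz Iy zy; have h2 := slope_le PP Iy Iu (ltW yu).
  have dc : d = c by apply/eqP; rewrite eq_le -{1}ud -yc h2 /= -zd h1.
  have : lo c <= z by apply: lo_le; rewrite -dc.
  by rewrite E leNgt zq.
rewrite (prim_integral kP l0' (ltW lq) dq)
  (@integral_itv_slope (fun t => slope t * w t) d q d0 l0' (ltW lq) dq).
  by rewrite lee_fin; have := amq (lo d) (dom_le l0' (ltW lq) dq); rewrite /excess; lra.
by move=> u lu uq; have [_ -> _] := inn u lu uq.
Qed.

(** On a piece h (slope) is constant and, for c > 0, v = k / c, so maximality at [lo c] suffices.
    The factor h serves twice: h = 1 gives the majorization of v by w, and a rescaled phi compares
    the modulars. *)
Lemma le_integral_optimal x (h : R -> R) : dom a x -> measurable_fun (oint 0 a) (h \o slope) ->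
  (forall t, oint 0 a t -> 0 <= h (slope t)) ->
  (\int[mu]_(t in `]0%R, x[) (h (slope t) * v t)%:E <=
   \int[mu]_(t in `]0%R, x[) (h (slope t) * w t)%:E)%E.
Proof.
move=> dx mh h0; have sx := sub_itv_oint dx.
have Ix u : 0 < u -> u < x -> oint 0 a u by move=> u0 ul; apply: sx; rewrite /= in_itv/= u0.
have mh' : measurable_fun `]0, x[ (h \o slope).
  by apply: measurable_funS mh => //; exact: measurable_oint.
apply: le_integral_slope => //.
- by apply/measurable_EFinP; apply: measurable_funM mh' _; exact: measurable_optimal_weight.
- by apply/measurable_EFinP; apply: measurable_funM mh' _; exact: measurable_weight.
- move=> t t0 /(Ix _ t0) It; rewrite lee_fin mulr_ge0 ?h0//.
  exact/ltW/optimal_weight_gt0.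
- by move=> t t0 /(Ix _ t0) It; rewrite lee_fin mulr_ge0 ?h0//; exact/ltW/w_gt0.
- move=> t t0 /(Ix _ t0) It nit nj; rewrite /optimal_weight; case: asboolP => [[]//|_].
  by [].
move=> c q c0 lq [[l0 _] am] dq qh _ _ inn.
have sub t : `]lo c, q[%classic t -> oint 0 a t.
  by rewrite /= in_itv/= => /andP[lt tq]; have [] := inn t lt tq.
have [c_gt0|c_le0] := ltP 0 c; last first.
  rewrite le_eqVlt; apply/orP; left; apply/eqP/eq_lebesgue_integral => t.
  rewrite /= in_itv/= => /andP[lt tq]; have [_ tc _] := inn t lt tq.
  by rewrite /optimal_weight; case: asboolP => // -[_]; rewrite tc ltNge c_le0.
have hc0 : 0 <= h c.
  have [lm mq] : lo c < (lo c + q) / 2 /\ (lo c + q) / 2 < q by split; lra.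
  by have [Im mc _] := inn _ lm mq; rewrite -mc h0.
rewrite (@eq_lebesgue_integral _ _ _ (fun t => (h c / c)%:E * (k t)%:E)%E); last first.
  move=> t; rewrite /= in_itv/= => /andP[lt tq]; have [_ tc it] := inn t lt tq.
  rewrite /optimal_weight; case: asboolP => [_|]; last by case; rewrite tc.
  by rewrite tc -EFinM; congr EFin; ring.
rewrite [leRHS](@eq_lebesgue_integral _ _ _ (fun t => (h c)%:E * (w t)%:E)%E); last first.
  move=> t; rewrite /= in_itv/= => /andP[lt tq]; have [_ tc it] := inn t lt tq.
  by rewrite tc EFinM.
have hcc : 0 <= h c / c by rewrite divr_ge0.
rewrite ge0_integralZl_EFin//; last 2 first.
- by move=> t /sub It; rewrite lee_fin (dec_ge0 kP).
- exact: (measurable_itv_k kP).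
rewrite ge0_integralZl_EFin//; last 2 first.
- by move=> t /sub It; rewrite lee_fin (dec_ge0 wP).
- exact: (measurable_itv_k wP).
rewrite (prim_integral kP l0 (ltW lq) dq) (prim_integral wP l0 (ltW lq) dq) -!EFinM lee_fin.
have Fq : F q - F (lo c) <= c * (W q - W (lo c)) by have := am q dq; rewrite /excess; lra.
by rewrite -mulrA ler_wpM2l// mulrC ler_pdivrMr// mulrC.
Qed.

End level_function_theory.

(** * The integral of the part of f^0 above s w *)

Section excess_integral.
Variables (R : realType) (a : \bar R) (k w : R -> R) (A B : R).
Local Notation mu := (@lebesgue_measure R).
Hypothesis kP : decreasing_on a k.
Hypothesis wP : decreasing_on a w.
Hypothesis w_gt0 : forall t, oint 0 a t -> 0 < w t.
Hypothesis k_rc : forall t c, oint 0 a t ->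
  (forall y, t < y -> oint 0 a y -> k y <= c) -> k t <= c.
Hypothesis FAB : forall y, dom a y -> prim a k y <= A * prim a w y + B.
Local Notation F := (prim a k).
Local Notation W := (prim a w).
Local Notation slope := (slope a F W).
Local Notation lo := (lo a F W).
Local Notation hi := (hi a F W).
Local Notation plateau := (plateau a F W).
Let PP := primitive_pair_prim kP wP w_gt0 FAB.

(** Majorization speaks only of points of I; continuity carries the bound to a finite end point
    a. *)
Lemma excess_dom_le s m : (forall y, oint 0 a y -> excess F W s y <= m) ->
  forall y, dom a y -> 0 < y -> excess F W s y <= m.
Proof.
move=> H y dy y0; have := dy.2; rewrite le_eqVlt => /predU1P[ya|ya]; last first.
  by apply: H; apply/andP; rewrite lte_fin.
apply/ler_addgt0Pr => e e0.
have := @excess_cont _ _ _ _ _ _ PP s y; move/(@cvgrPdist_lt _ R^o)/(_ _ e0) => [d /= d0 Hd].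
set z := Num.max (y / 2) (y - d / 2).
have zy : z < y by rewrite gt_max; apply/andP; split; lra.
have z0 : 0 < z by rewrite lt_max; apply/orP; left; lra.
have dz : y - d / 2 <= z by rewrite le_max lexx orbT.
have Iz : oint 0 a z by apply/andP; rewrite -ya !lte_fin.
have := Hd z; rewrite /ball_/= ger0_norm; last lra.
have yz : y - z < d by lra.
move=> /(_ yz); rewrite ltr_norml => /andP[_].
have := H z Iz; lra.
Qed.

(** The sum before - s W x is the least W-concave majorant of F at x. Lateness at x for c' just
    below c provides y >= x whose excess nearly dominates; this works for an infinite [hi] too. *)
Lemma level_excess_le s m x : 0 < s -> (forall y, oint 0 a y -> excess F W s y <= m) ->
  oint 0 a x -> s < slope x ->
  F (lo (slope x)) + slope x * (W x - W (lo (slope x))) - s * W x <= m.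
Proof.
move=> s0 H Ix sx; set c := slope x.
have pt : plateau c x by [].
have l0 := lo_ge0 pt; have lx := lo_le pt; have x0 := oint_gt0 Ix.
have dx := oint_dom Ix.
have D0 : 0 <= W x - W (lo c) by rewrite subr_ge0; apply: prim_mono.
apply/ler_addgt0Pr => e e0.
have q0 : 0 < W x - W (lo c) + 1 by lra.
(* Replacing c by c' costs at most e on (lo c, x), and c' >= s lets W x be exchanged for W y. *)
set c' := Num.max s (c - e / (W x - W (lo c) + 1)).
have c'c : c' < c by rewrite gt_max sx/= ltrBlDr ltrDl divr_gt0.
have sc' : s <= c' by rewrite le_max lexx.
have c'0 : 0 <= c' by lra.
have [|y [dy xy]] := (late_lt PP Ix c'0 c'c).2 (lo c); first by rewrite l0.
have y0 : 0 < y by lra.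
have := excess_dom_le H dy y0.
have : W x <= W y by apply: prim_mono => //; exact: ltW.
have : (c - c') * (W x - W (lo c)) <= e.
  have h1 : c - c' <= e / (W x - W (lo c) + 1).
    by rewrite lerBlDl -lerBlDr le_max lexx orbT.
  have h2 : (c - c') * (W x - W (lo c)) <= e / (W x - W (lo c) + 1) * (W x - W (lo c)).
    by rewrite ler_wpM2r.
  have h3 : e / (W x - W (lo c) + 1) * (W x - W (lo c) + 1) = e.
    by rewrite divfK// gt_eqF.
  have : 0 < e / (W x - W (lo c) + 1) by rewrite divr_gt0.
  lra.
rewrite /excess => h1 h2 h3 h4.
have : (c' - s) * W x <= (c' - s) * W y by rewrite ler_wpM2l// subr_ge0.
lra.
Qed.

(** On (0, x) the slope exceeds s, so the positive part is linear. The integral of slope * w is at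
    most the majorant at x: [ge_integral_level] up to the plateau of x, then linear growth. *)
Lemma slope_excess_itv s m x : 0 < s -> (forall y, oint 0 a y -> excess F W s y <= m) ->
  oint 0 a x -> s < slope x ->
  (\int[mu]_(t in `]0%R, x[) maxe ((slope t * w t)%:E - (s * w t)%:E) 0 <= m%:E)%E.
Proof.
move=> s0 H Ix sx; set c := slope x.
have pt : plateau c x by [].
have l0 := lo_ge0 pt; have lx := lo_le pt; have x0 := oint_gt0 Ix.
have dx := oint_dom Ix; have subI := sub_itv_oint dx.
have Iu u : 0 < u -> u < x -> oint 0 a u by move=> u0 ul; apply: subI; rewrite /= in_itv/= u0.
have mL := measurable_slope_weight kP wP w_gt0 FAB.
have mw : measurable_fun `]0, x[ w by exact: (measurable_weight wP).
set L := (\int[mu]_(t in `]0%R, x[) (slope t * w t)%:E)%E.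
have LE : (L = \int[mu]_(t in `]0%R, x[) maxe ((slope t * w t)%:E - (s * w t)%:E) 0 +
               (s * W x)%:E)%E.
  have -> : (s * W x)%:E = (\int[mu]_(t in `]0%R, x[) (s%:E * (w t)%:E))%E.
    rewrite ge0_integralZl_EFin//.
    - by rewrite (prim_integral wP (lexx 0) (ltW x0) dx) prim0 subr0 EFinM.
    - by move=> t /subI/w_gt0/ltW; rewrite lee_fin.
    - exact/measurable_EFinP.
    - exact: ltW.
  rewrite -ge0_integralD//.
  - apply: eq_lebesgue_integral => t; rewrite /= in_itv/= => /andP[t0 tx].
    have It := Iu t t0 tx.
    have st : s <= slope t by apply/ltW/(lt_le_trans sx)/(slope_le PP It Ix)/ltW.
    have -> : (maxe ((slope t * w t)%:E - (s * w t)%:E) 0 = (slope t * w t - s * w t)%:E)%E.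
      by rewrite -EFinB; apply/max_idPl; rewrite lee_fin -mulrBl mulr_ge0 ?subr_ge0// ltW// w_gt0.
    by rewrite -EFinM -EFinD; congr EFin; ring.
  - by move=> t _; rewrite le_max lexx orbT.
  - by apply: measurable_excess_part => //; exact: mL.
  - by move=> t /subI/w_gt0 wt; rewrite -EFinM lee_fin mulr_ge0// ltW.
  - by apply/measurable_EFinP; apply: measurable_funM.
have Lle : (L <= (F (lo c) + c * (W x - W (lo c)))%:E)%E.
  rewrite /L (@ge0_integral_itv_split _ 0 (lo c) x)//.
  - rewrite EFinD; apply: leeD; first exact: (ge_integral_level kP wP w_gt0 k_rc FAB pt).
    have c0 : 0 <= c by exact: (slope_ge0 PP).
    rewrite (@integral_itv_slope R a k w wP w_gt0 (fun t => slope t * w t) c x c0 l0 lx dx)//.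
    move=> t lt tx; have [_ -> //] : plateau c t.
    by apply: (plateau_itv PP); apply/andP; rewrite lte_fin lt; split=> //;
      apply: lt_le_trans (hi_ge pt); rewrite lte_fin.
  - exact: mL.
  - move=> t t0 tx; have It := Iu t t0 tx; rewrite lee_fin mulr_ge0 ?(slope_ge0 PP)//.
    exact/ltW/w_gt0.
move: Lle; rewrite LE; set X := (integral _ _ _) => Lle.
have := level_excess_le s0 H Ix sx; rewrite -/c => hm.
apply: (@le_trans _ _ ((F (lo c) + c * (W x - W (lo c)))%:E - (s * W x)%:E)%E).
  by rewrite leeBrDr.
by rewrite -EFinB lee_fin.
Qed.

Lemma slope_excess_integral s (m : \bar R) : 0 < s -> (0 <= m)%E ->
  (forall y, oint 0 a y -> ((excess F W s y)%:E <= m)%E) ->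
  (\int[mu]_(t in oint 0 a) maxe ((slope t * w t)%:E - (s * w t)%:E) 0 <= m)%E.
Proof.
move=> s0; case: m => [m| |]// m0 H; last by rewrite leey.
have {}H y : oint 0 a y -> excess F W s y <= m by move=> /H; rewrite lee_fin.
pose h t := (maxe ((slope t * w t)%:E - (s * w t)%:E) 0)%E.
have h0 t : (0 <= h t)%E by rewrite le_max lexx orbT.
have mIo := @measurable_oint R 0 a.
have mh : measurable_fun (oint 0 a) h.
  apply: measurable_excess_part => //.
    exact: (measurable_slope_weight kP wP w_gt0 FAB).
  exact: (measurable_weight wP).
pose S := [set t | oint 0 a t /\ s < slope t].
pose b := ereal_sup (EFin @` S).
have hS t : oint 0 a t -> ~ S t -> h t = 0%E.
  move=> It nS; apply/max_idPr; rewrite -EFinB lee_fin -mulrBl pmulr_lle0 ?w_gt0// subr_le0.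
  by rewrite leNgt; apply/negP => st; apply: nS.
have [S0|/set0P[t1 St1]] := eqVneq S set0.
  rewrite (@eq_lebesgue_integral _ _ h (cst 0%E)) ?integral0// => t It.
  by apply: hS => //; rewrite S0.
have b0 : (0 < b)%E.
  apply: (@lt_le_trans _ _ t1%:E); first by rewrite lte_fin (oint_gt0 St1.1).
  by apply: ereal_sup_ubound; exists t1.
have ba : (b <= a)%E by apply: ge_ereal_sup => _ [u [/andP[_ /ltW ua] _] <-].
have bS t : oint 0 b t -> S t.
  case/andP; rewrite lte_fin => t0 /ereal_sup_gt[_ [u [Iu su] <-]]; rewrite lte_fin => tu.
  have It := oint_lt t0 (ltW tu) Iu; split=> //.
  by apply: lt_le_trans su _; apply: (slope_le PP) => //; exact: ltW.
have bI : oint 0 b `<=` oint 0 a by move=> t /bS[].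
(* S and (0, b) differ at most by the point b. If b is infinite, [fine b] is 0, outside I, and
   removing it changes nothing. *)
have Sb t : S t -> ~ oint 0 b t -> t = fine b.
  move=> St nb; have : (t%:E <= b)%E by apply: ereal_sup_ubound; exists t.
  rewrite le_eqVlt => /predU1P[<-//|tb]; exfalso; apply: nb.
  by apply/andP; rewrite lte_fin (oint_gt0 St.1).
have -> : (\int[mu]_(t in oint 0 a) h t = \int[mu]_(t in oint 0 b) h t)%E.
  have E J : measurable J -> J `<=` oint 0 a ->
      (\int[mu]_(t in J) h t = \int[mu]_(t in J `\` [set fine b]) h t)%E.
    move=> mJ JI; apply: ge0_negligible_integral => //; first exact: measurable_funS mh.
    exact: lebesgue_measure_set1.
  rewrite (E _ mIo)// (E _ (measurable_oint 0 b) bI).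
  rewrite integral_mkcond [RHS]integral_mkcond; congr (integral _ _ _).
  apply/funext => t; rewrite !patchE; case: ifPn => [/set_mem[It tb]|].
    case: ifPn => // /negP; rewrite inE => nb; apply: hS => // St; apply: nb; split=> //.
    by apply: contrapT => /(Sb t St).
  move=> /negP; rewrite inE => na; case: ifPn => // /set_mem[Ib tb]; exfalso; apply: na.
  by split=> //; exact: bI.
apply: integral_oint_sup => //; first exact: measurable_funS mh.
by move=> x /bS[Ix sx]; exact: slope_excess_itv.
Qed.

End excess_integral.

(** * The level function *)

Lemma oint_subset (R : realType) (x y x' y' : \bar R) : (x < y)%E -> (-oo < x)%E ->
  oint x y `<=` oint x' y' -> (x' <= x)%E /\ (y <= y')%E.
Proof.
move=> xy xNy sub.
have [r ry] : exists r : R, oint x y r.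
  case: x xNy xy {sub} => [x| |]// _; last by case: y.
  by move=> /between_ereal/(_ ltr01)[r [xr _ ry]]; exists r; apply/andP; rewrite lte_fin.
have /andP[xr ry'] := ry; split.
  rewrite leNgt; apply/negP => xx'.
  have : (x' < r%:E)%E by have /andP[] := sub r ry.
  case: x xNy xx' xr {ry xy} sub => [x| |]// _ xx' xr sub x'r.
  have [z [xz _ zx']] := between_ereal xx' ltr01.
  have /sub/andP[] : oint x%:E y z.
    by apply/andP; rewrite lte_fin xz; split=> //; exact: lt_trans (lt_trans zx' x'r) ry'.
  by rewrite ltNge ltW.
rewrite leNgt; apply/negP => y'y.
have /sub/andP[_ ry2] := ry.
case: y' ry2 y'y sub => [y'| |]//; rewrite ?lte_fin => ry2 y'y sub; last by case: (y) y'y.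
have [z [yz _ zy]] := between_ereal y'y ltr01.
have /sub/andP[_] : oint x y z.
  by apply/andP; split=> //; apply: lt_trans xr _; rewrite lte_fin (lt_trans ry2).
by rewrite lte_fin ltNge ltW.
Qed.

Section level_function_slope.
Variables (R : realType) (a : \bar R) (w f : R -> R) (A B : R).
Local Notation mu := (@lebesgue_measure R).
Definition fstar (t : R) : R := fine (rearr a (EFin \o f) t).
Local Notation k := fstar.
Hypothesis kE : forall t, oint 0 a t -> rearr a (EFin \o f) t = (k t)%:E.
Hypothesis kP : decreasing_on a k.
Hypothesis wP : decreasing_on a w.
Hypothesis w_gt0 : forall t, oint 0 a t -> 0 < w t.
Hypothesis k_rc : forall t c, oint 0 a t ->
  (forall y, t < y -> oint 0 a y -> k y <= c) -> k t <= c.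
Hypothesis FAB : forall y, dom a y -> prim a k y <= A * prim a w y + B.
Local Notation F := (prim a k).
Local Notation W := (prim a w).
Local Notation slope := (slope a F W).
Local Notation lo := (lo a F W).
Local Notation hi := (hi a F W).
Local Notation plateau := (plateau a F W).
Let PP := primitive_pair_prim kP wP w_gt0 FAB.

Lemma ratioE x y : 0 <= x -> x < y -> dom a y ->
  Defs.ratio a w f x y = ((F y - F x) / (W y - W x))%:E.
Proof.
move=> x0 xy dy; rewrite /Defs.ratio (prim_integral wP x0 (ltW xy) dy).
rewrite (@eq_lebesgue_integral _ _ _ (fun t => (k t)%:E)); last first.
  by move=> t /=; rewrite in_itv/= => /andP[xt ty]; apply: kE; apply: dom_oint dy => //; lra.
rewrite (prim_integral kP x0 (ltW xy) dy) inver gt_eqF ?EFinM//.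
by rewrite subr_gt0; apply: (pair_Wlt PP).
Qed.

Lemma ratio_le x y s : 0 <= x -> x < y -> dom a y ->
  (Defs.ratio a w f x y <= s%:E)%E = (F y - F x <= s * (W y - W x)).
Proof.
move=> x0 xy dy; rewrite ratioE// lee_fin ler_pdivrMr// subr_gt0.
exact: (pair_Wlt PP).
Qed.

Lemma ratio_ge x y s : 0 <= x -> x < y -> dom a y ->
  (s%:E <= Defs.ratio a w f x y)%E = (s * (W y - W x) <= F y - F x).
Proof.
move=> x0 xy dy; rewrite ratioE// lee_fin ler_pdivlMr// subr_gt0.
exact: (pair_Wlt PP).
Qed.

(** Both ends of a bounded plateau maximise [excess c]. On an unbounded one all ratios are at most
    c, and ratios above c - e occur arbitrarily far out. *)
Lemma eratio_plateau c t : plateau c t -> 0 < c -> ((lo c)%:E < hi c)%E ->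
  eratio a w f (lo c) (hi c) = c%:E.
Proof.
move=> pt c0 lh; have l0 := lo_ge0 pt; have [dl am] := lo_argmax PP pt.
have [_ _ ha _ [lev1 lev2]] := plateau_level PP pt c0 lh.
move: lh ha lev1 lev2; case hE : (hi c) => [h| |]// lh ha lev1 lev2 /=.
  have [dh amh] := hi_argmax PP pt hE; rewrite lte_fin in lh.
  apply/eqP; rewrite eq_le ratio_le// ratio_ge//; apply/andP; split.
    by apply: lev1; rewrite ?lexx ?ltW.
  by have := amh _ dl; rewrite /excess; lra.
have dom0 r : 0 <= r -> dom a r by move=> r0; split=> //; apply: le_trans ha; rewrite leey.
apply/eqP; rewrite eq_le; apply/andP; split.
  apply: ge_ereal_inf; exists (ereal_sup (Defs.ratio a w f (lo c) @` [set r | lo c < r])).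
    exists [set r | lo c < r] => //; exists (lo c); split=> //; exact: num_real.
  apply: ge_ereal_sup => _ [r /= lr <-].
  have dr : dom a r by apply: dom0; lra.
  by rewrite ratio_le//; apply: lev1; rewrite ?leey ?ltW.
apply: le_ereal_inf_tmp => _ [V [M [_ MV]] <-].
apply/lee_addgt0Pr => e e0; have ce : c - e < c by lra.
have [r [Mr _ lr]] := lev2 (c - e) (Num.max M (lo c)) ce (ltry _).
move: Mr; rewrite gt_max => /andP[Mr lor].
rewrite -leeBlDr//; apply: (@le_trans _ _ (Defs.ratio a w f (lo c) r)); last first.
  by apply: ereal_sup_ubound; exists r => //; exact: MV.
by rewrite -EFinB ratio_ge//; apply: dom0; lra.
Qed.

Lemma plateau_level_interval c t : plateau c t -> 0 < c -> ((lo c)%:E < hi c)%E ->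
  level_interval a w f (lo c) (hi c).
Proof.
move=> pt c0 lh; have l0 := lo_ge0 pt.
have E := eratio_plateau pt c0 lh.
have [_ _ ha _ [lev1 lev2]] := plateau_level PP pt c0 lh.
split=> //.
- move=> u /andP[]; rewrite lte_fin => lu uh; apply/andP; rewrite lte_fin (le_lt_trans l0)//.
  by split=> //; exact: lt_le_trans ha.
- by rewrite E lte_fin.
- move=> u /andP[]; rewrite lte_fin => lu uh; rewrite E ratio_le//.
    by apply: lev1; exact: ltW.
  by split; [lra|apply/ltW/(lt_le_trans uh)].
Qed.

Lemma level_interval_at al b : level_interval a w f al b ->
  exists s, level_at a F W al b s.
Proof.
case=> al0 alb sub; have [_ ba] := oint_subset alb (ltNyr _) sub.
have dr r : al <= r -> (r%:E <= b)%E -> dom a r.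
  by move=> alr rb; split; [lra|exact: le_trans ba].
case: b alb ba dr {sub} => [b| |]//.
  rewrite lte_fin => alb ba dr; rewrite /eratio.
  have db : dom a b by apply: dr; rewrite ?lexx ?ltW.
  rewrite (ratioE al0 alb db); set s := (_ / _); rewrite lte_fin => s0 H.
  have WW : 0 < W b - W al by rewrite subr_gt0; apply: (pair_Wlt PP).
  have sE : s * (W b - W al) = F b - F al by rewrite divfK// gt_eqF.
  exists s; split=> //; split=> [r alr rb|s' T s's Tb].
    rewrite lee_fin in rb; move: alr; rewrite le_eqVlt => /predU1P[->|alr].
      by rewrite !subrr mulr0.
    move: rb; rewrite le_eqVlt => /predU1P[->|rb]; first by rewrite sE.
    rewrite -ratio_le//; last by apply: dr; rewrite ?lee_fin ltW.
    by apply: H; apply/andP; rewrite !lte_fin.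
  by exists b; rewrite lexx -lte_fin; split=> //; rewrite -sE ler_pM2r// ltW.
move=> _ ba dr0 lim0 H.
have dr r : al <= r -> dom a r by move=> alr; apply: dr0; rewrite ?leey.
set L := eratio a w f al +oo%E in lim0 H.
have [s Ls] : exists s, L = s%:E.
  have W1 : 0 < W (al + 1) - W al.
    by rewrite subr_gt0; apply: (pair_Wlt PP) => //; [lra|apply: dr; lra].
  (* The limsup must first be seen to be finite: the affine bound gives F r - F al <= |A| (W r - W
     al) + |A| W al + |B|, and for r > al + 1 the divisor is at least W (al + 1) - W al. *)
  suff : (L <= (`|A| + (`|A| * W al + `|B|) / (W (al + 1) - W al))%:E)%E.
    by move: lim0; case: L H => [s| |]// H _ _; exists s.
  apply: ge_ereal_inf; eexists.
    by exists [set r | al + 1 < r]; [exists (al + 1); split=> //; exact: num_real|reflexivity].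
  apply: ge_ereal_sup => _ [r /= lr <-].
  have alr : al < r by lra.
  have drr := dr r (ltW alr); have dal := dr al (lexx _).
  rewrite ratio_le//.
  have h1 : W (al + 1) <= W r by apply: prim_mono => //; lra.
  have h2 := FAB drr; have h3 : 0 <= F al by rewrite -[leLHS](pair_F0 PP); apply: (pair_Fle PP).
  have h4 := W_ge0 PP dal; have h5 := W_ge0 PP drr.
  have h6 := ler_norm A; have h7 := ler_norm B.
  have n0 : 0 <= `|A| * W al + `|B| by rewrite addr_ge0 ?mulr_ge0.
  have h8 : (`|A| * W al + `|B|) <= (`|A| * W al + `|B|) / (W (al + 1) - W al) * (W r - W al).
    by rewrite mulrAC ler_pdivlMr// ler_wpM2l// lerD2r.
  have h9 : A * W r <= `|A| * W r by rewrite ler_wpM2r.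
  lra.
rewrite Ls lte_fin in lim0; exists s; split=> //; first by rewrite ltry.
split=> [r alr _|s' T s's _].
  move: alr; rewrite le_eqVlt => /predU1P[->|alr]; first by rewrite !subrr mulr0.
  rewrite -ratio_le//; last by apply: dr; exact: ltW.
  by rewrite -Ls; apply: H; apply/andP; rewrite lte_fin ltry.
apply: contrapT => nr; have : (L <= s'%:E)%E; last by rewrite Ls lee_fin leNgt s's.
apply: ge_ereal_inf; eexists.
  by exists [set r | Num.max T al < r]; [exists (Num.max T al); split=> //; exact: num_real|reflexivity].
apply: ge_ereal_sup => _ [r /= + <-]; rewrite gt_max => /andP[Tr alr].
rewrite ratio_le//; last by apply: dr; exact: ltW.
rewrite leNgt; apply/negP => /ltW lt; apply: nr; exists r.
by rewrite leey.
Qed.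

(** A chosen maximal interval lies in the level interval of its plateau, hence equals it. If none
    contains t, then t is not an inner point of positive slope, so v = w at t and k = slope * w. *)
Lemma level_funE t : oint 0 a t -> ~ jumps a k w t ->
  level_fun a w f t = (slope t * w t)%:E.
Proof.
move=> It nj; have pt : plateau (slope t) t by [].
rewrite /level_fun; case: pselect => [ex|nex].
  case: cid => -[al b] /= [[lev maxl] ot].
  have [s levs] := level_interval_at lev.
  have c0 := level_slope_gt0 PP levs ot.
  have [lal bh] := level_sub PP levs ot.
  have lh : ((lo (slope t))%:E < hi (slope t))%E.
    have /andP[alt tb] := ot; apply: (@le_lt_trans _ _ al%:E); rewrite ?lee_fin//.
    exact: lt_le_trans (lt_trans alt tb) bh.
  have [|<- <-] := maxl _ _ (plateau_level_interval pt c0 lh).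
    move=> u /andP[alu ub]; apply/andP; split; last exact: lt_le_trans bh.
    by apply: le_lt_trans alu; rewrite lee_fin.
  by rewrite (eratio_plateau pt c0 lh) EFinM.
rewrite kE//; congr EFin.
rewrite (slope_optimal_weight kP wP w_gt0 k_rc FAB It nj) /optimal_weight.
case: asboolP => // -[it c0]; exfalso; apply: nex.
have lh : ((lo (slope t))%:E < hi (slope t))%E by have /andP[] := it; exact: lt_trans.
exists (lo (slope t), hi (slope t)); split=> //; split; first exact: plateau_level_interval pt c0 lh.
move=> al b lev sub; have [s levs] := level_interval_at lev.
have [lal bh] := level_sub PP levs (sub _ it).
have [] := oint_subset lh (ltNyr _) sub; rewrite lee_fin => all hb.
by split; apply/eqP; rewrite eq_le ?all ?bh.
Qed.

End level_function_slope.

(** * Rearrangements, gauges and finiteness *)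

Section rearrangement.
Variables (R : realType) (a : \bar R).
Local Notation mu := (@lebesgue_measure R).
Implicit Types (f g : R -> \bar R) (s t l : R).

Lemma rearr_ge0 f t : (0 <= rearr a f t)%E.
Proof. by apply: le_ereal_inf_tmp => _ [l [/ltW l0 _] <-]; rewrite lee_fin. Qed.

Lemma rearr_le f s t : s <= t -> (rearr a f t <= rearr a f s)%E.
Proof.
move=> st; apply: le_ereal_inf_tmp => _ [l [l0 dl] <-]; apply: ereal_inf_lbound.
by exists l => //; split=> //; apply: le_trans dl _; rewrite lee_fin.
Qed.

Lemma measurable_rearr (D : set R) f : measurable D -> measurable_fun D (rearr a f).
Proof.
move=> mD; apply: measurable_funTS; apply: nonincreasing_in_measurable => //.
by move=> s t _ _; exact: rearr_le.
Qed.

(** For every y > t in I the distribution function at c + e is at most y; let y decrease to t. *)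
Lemma rearr_rc f t (c : \bar R) : oint 0 a t ->
  (forall y, t < y -> oint 0 a y -> (rearr a f y <= c)%E) -> (rearr a f t <= c)%E.
Proof.
move=> It H; have c0 : (0 <= c)%E.
  have /andP[_ /between_ereal/(_ ltr01)[y [ty _ ya]]] := It.
  apply: le_trans (rearr_ge0 f y) (H y ty _).
  by apply/andP; rewrite lte_fin; split=> //; exact: lt_trans (oint_gt0 It) ty.
case: c c0 H => [c| |]//; last by move=> *; rewrite leey.
rewrite lee_fin => c0 H; apply/lee_addgt0Pr => e e0.
apply: ereal_inf_lbound; exists (c + e) => //; split; first lra.
apply/lee_addgt0Pr => d d0.
have /andP[_ ta] := It; have [y [ty yd ya]] := between_ereal ta d0.
have Iy : oint 0 a y by apply/andP; rewrite lte_fin (lt_trans (oint_gt0 It)).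
have : (rearr a f y < (c + e)%:E)%E by apply: le_lt_trans (H y ty Iy) _; rewrite lte_fin ltrDl.
move=> /ereal_inf_lt[_ [l [l0 dl] <-]]; rewrite lte_fin => lc.
apply: (@le_trans _ _ (distr a f l)).
  by apply: le_lebesgue_measure => x [Ix cx]; split=> //; apply: lt_trans cx; rewrite lte_fin.
by apply: le_trans dl _; rewrite -EFinD lee_fin ltW.
Qed.

Lemma rearr_div f l t : 0 < l -> rearr a (fun x => f x / l%:E)%E t = (rearr a f t / l%:E)%E.
Proof.
have aux g m : 0 < m -> (rearr a g t / m%:E <= rearr a (fun x => g x / m%:E) t)%E.
  move=> m0; apply: le_ereal_inf_tmp => _ [y [y0 dy] <-].
  rewrite inver gt_eqF// lee_pdivrMr// -EFinM; apply: ereal_inf_lbound.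
  exists (y * m) => //; split; first by rewrite mulr_gt0.
  apply: le_trans dy; apply: le_lebesgue_measure => x [Ix yx]; split=> //.
  by rewrite inver gt_eqF// abseM [X in (_ * X)%E]gee0_abs ?lee_fin ?invr_ge0 ?ltW// lte_pdivlMr.
move=> l0; apply/eqP; rewrite eq_le aux// andbT.
have li0 : 0 < l^-1 by rewrite invr_gt0.
have := aux (fun x => f x / l%:E)%E _ li0.
have -> : (fun x => f x / l%:E / (l^-1)%:E)%E = f.
  apply/funext => x; rewrite !inver (gt_eqF l0) (gt_eqF li0) -muleA -EFinM mulfV ?mule1//.
  by rewrite (gt_eqF li0).
by rewrite !inver (gt_eqF l0) (gt_eqF li0) invrK lee_pdivlMr.
Qed.

Lemma decreasing_weight_on (v : R -> R) : (0 < a)%E -> decreasing_weight a v ->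
  (forall t, oint 0 a t -> (\int[mu]_(s in `]0%R, t[) (v s)%:E < +oo)%E) -> decreasing_on a v.
Proof.
move=> a0 [vgt vle] vfin; split=> //.
  by move=> t It; apply/ltW/vgt; rewrite inE.
by move=> s t Is It st; apply: vle => //; rewrite inE.
Qed.

Lemma ge0_eq_integral_countable (D N : set R) (f g : R -> \bar R) : measurable D -> countable N ->
  measurable_fun D f -> measurable_fun D g ->
  (forall t, D t -> (0 <= f t)%E) -> (forall t, D t -> (0 <= g t)%E) ->
  (forall t, D t -> ~ N t -> f t = g t) ->
  (\int[mu]_(t in D) f t = \int[mu]_(t in D) g t)%E.
Proof.
move=> mD cN mf mg f0 g0 H; apply: ge0_ae_eq_integral => //.
exists N; split; [exact: countable_measurable|exact: countable_lebesgue_measure0|].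
move=> t /= nH; apply: contrapT => Nt; apply: nH => Dt; exact: H.
Qed.

Lemma rearr_nonincreasing (v : R -> R) :
  (forall t, oint 0 a t -> 0 <= v t) ->
  (forall s t, oint 0 a s -> oint 0 a t -> s <= t -> v t <= v s) ->
  exists2 N, countable N & forall t, oint 0 a t -> ~ N t -> rearr a (EFin \o v) t = (v t)%:E.
Proof.
move=> v0 vle; apply: (@rearr_ae_nonincreasing _ a (EFin \o v) set0); first exact: countable0.
  by move=> t It; rewrite lee_fin v0.
by move=> s t Is It _ _ /ltW st; rewrite lee_fin vle.
Qed.

Lemma integral_rearr_nonincreasing (v : R -> R) x : oint 0 a x ->
  (forall t, oint 0 a t -> 0 <= v t) ->
  (forall s t, oint 0 a s -> oint 0 a t -> s <= t -> v t <= v s) ->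
  (\int[mu]_(t in `]0%R, x[) rearr a (EFin \o v) t = \int[mu]_(t in `]0%R, x[) (v t)%:E)%E.
Proof.
move=> Ix v0 vle; have [N cN HN] := rearr_nonincreasing v0 vle.
have sub := sub_itv_oint (oint_dom Ix).
apply: (ge0_eq_integral_countable _ cN) => //.
- exact: measurable_rearr.
- apply: (@measurable_funS _ _ _ _ (oint 0 a)) => //; first exact: measurable_oint.
  apply: nonincreasing_in_measurable; first exact: is_interval_oint.
  by move=> s t Is It st; rewrite lee_fin vle.
- by move=> t _; exact: rearr_ge0.
- by move=> t /sub It; rewrite lee_fin v0.
- by move=> t /sub It; exact: HN.
Qed.

End rearrangement.

Section gauges.
Variables (R : realType).
Implicit Types (rho : (R -> \bar R) -> \bar R) (f : R -> \bar R).

(** The only property of the two gauges that is used. Two modulars appear so that the weight may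
    change along with the function. *)
Definition monotone_gauge (gauge : ((R -> \bar R) -> \bar R) -> (R -> \bar R) -> \bar R) :=
  forall rho1 rho2 f1 f2, (forall l : R, 0 < l ->
    (rho1 (fun x => f1 x / l%:E) <= rho2 (fun x => f2 x / l%:E))%E) ->
  (gauge rho1 f1 <= gauge rho2 f2)%E.

Lemma luxemburg_monotone : monotone_gauge (@luxemburg R).
Proof.
move=> rho1 rho2 f1 f2 H; apply: le_ereal_inf_tmp => _ [l [l0 Hl] <-].
by apply: ereal_inf_lbound; exists l => //; split=> //; exact: le_trans (H l l0) Hl.
Qed.

Lemma amemiya_monotone : monotone_gauge (@amemiya R).
Proof.
move=> rho1 rho2 f1 f2 H; apply: le_ereal_inf_tmp => _ [t t0 <-].
apply: le_trans (ereal_inf_lbound _) _; first by exists t.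
by apply: lee_wpmul2l; [rewrite lee_fin ltW|apply: leeD2l; exact: H].
Qed.

End gauges.

Section finiteness.
Variables (R : realType) (a : \bar R) (phi w : R -> R).
Local Notation mu := (@lebesgue_measure R).
Hypothesis phi_orlicz : orlicz_function phi.
Hypothesis wP : decreasing_on a w.
Hypothesis w_gt0 : forall t, oint 0 a t -> 0 < w t.

(* Convexity gives [phi 1 * u <= phi 1 + phi u], whence local integrability. *)
Lemma calM_integral_bound (f : R -> R) : calM a phi w f ->
  exists A B, forall x, oint 0 a x ->
    (\int[mu]_(t in `]0%R, x[) rearr a (EFin \o f) t <= (A * prim a w x + B)%:E)%E.
Proof.
case=> _ [g [_ [l l0 Mfin]] fg].
have p1 : 0 < phi 1 by have [_ _ ->] := phi_orlicz.
pose G := rearr a (EFin \o (fun x => l * g x)).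
have GE t : G t = (rearr a (EFin \o g) t / (l^-1)%:E)%E.
  rewrite /G -rearr_div ?invr_gt0//; congr (rearr a _ t); apply/funext => x /=.
  by rewrite inver gt_eqF ?invr_gt0// invrK -EFinM mulrC.
pose P t := (er_map phi (G t / (w t)%:E) * (w t)%:E)%E.
have mI := @measurable_oint R 0 a.
have mw : measurable_fun (oint 0 a) w.
  by apply/measurable_EFinP; apply: (measurable_decr wP).
have G0 t : (0 <= G t)%E by exact: rearr_ge0.
have mG D : measurable D -> measurable_fun D G by exact: measurable_rearr.
have mP : measurable_fun (oint 0 a) P by apply: measurable_er_map_phi => //; exact: mG.
have P0 t : oint 0 a t -> (0 <= P t)%E.
  move=> It; apply: mule_ge0; last by rewrite lee_fin ltW// w_gt0.
  rewrite inver gt_eqF ?w_gt0//; have := G0 t; case: (G t) => [r| |]//.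
    by rewrite lee_fin => r0; rewrite lee_fin (phi_ge0 phi_orlicz)// divr_ge0// ltW// w_gt0.
  by move=> _; rewrite mulyr gtr0_sg ?invr_gt0 ?w_gt0// mul1e/= leey.
have GP t : oint 0 a t -> (G t <= (w t)%:E + ((phi 1)^-1)%:E * P t)%E.
  move=> It; have wt := w_gt0 It; rewrite /P inver gt_eqF//; have := G0 t.
  case: (G t) => [r| |]//; last first.
    move=> _; rewrite mulyr gtr0_sg ?invr_gt0// mul1e/= gt0_mulye ?lte_fin//.
    by rewrite gt0_muley ?lte_fin ?invr_gt0.
  rewrite lee_fin => r0; rewrite /= -!EFinM -EFinD lee_fin.
  set u := r / w t; have u0 : 0 <= u by rewrite divr_ge0// ltW.
  have -> : r = u * w t by rewrite divfK// gt_eqF.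
  have : u <= 1 + (phi 1)^-1 * phi u.
    have [u1|/ltW u1] := leP u 1.
      have := phi_ge0 phi_orlicz u0; have : 0 <= (phi 1)^-1 by rewrite invr_ge0 ltW.
      by nra.
    have := phi_chord phi_orlicz (lexx 0) ler01 u1.
    have [_ -> _] := phi_orlicz; rewrite mul0r add0r !subr0 mulr1 => h.
    have : u <= (phi 1)^-1 * phi u by rewrite ler_pdivlMl.
    by lra.
  have := phi_ge0 phi_orlicz u0; nra.
set M := modular a phi w _ in Mfin.
have ME : M = (\int[mu]_(t in oint 0 a) P t)%E by [].
have M0 : (0 <= M)%E by rewrite ME; exact: integral_ge0.
(* [GP] integrates to W x + M / phi 1, and the factor 1 / l turns G back into the rearrangement of
   g. *)
exists l^-1, (l^-1 * ((phi 1)^-1 * fine M)) => x Ix; apply: le_trans (fg x Ix) _.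
have sub := sub_itv_oint (oint_dom Ix).
have -> : (\int[mu]_(t in `]0%R, x[) rearr a (EFin \o g) t =
           \int[mu]_(t in `]0%R, x[) ((l^-1)%:E * G t))%E.
  apply: eq_lebesgue_integral => t _; rewrite GE inver gt_eqF ?invr_gt0// invrK.
  by rewrite muleCA -EFinM mulVf ?mule1// gt_eqF.
rewrite ge0_integralZl_EFin//; last 2 first.
- exact: mG.
- by rewrite invr_ge0 ltW.
rewrite -mulrDr EFinM; apply: lee_wpmul2l; first by rewrite lee_fin invr_ge0 ltW.
have mPx : measurable_fun `]0, x[ P by exact: measurable_funS mP.
apply: (@le_trans _ _ (\int[mu]_(t in `]0%R, x[) ((w t)%:E + ((phi 1)^-1)%:E * P t))%E).
  apply: ge0_le_integral => //; first exact: mG.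
  - apply: emeasurable_funD; first exact: (measurable_itv_k wP (lexx 0) (oint_dom Ix)).
    by apply: emeasurable_funM => //; exact: measurable_cst.
  - by move=> t /sub; exact: GP.
rewrite ge0_integralD//; last 4 first.
- by move=> t /sub/w_gt0/ltW; rewrite lee_fin.
- exact: (measurable_itv_k wP (lexx 0) (oint_dom Ix)).
- by move=> t /sub/P0 Pt; apply: mule_ge0 => //; rewrite lee_fin invr_ge0 ltW.
- by apply: emeasurable_funM => //; exact: measurable_cst.
rewrite (prim_integral wP (lexx 0) (ltW (oint_gt0 Ix)) (oint_dom Ix)) prim0 subr0.
rewrite EFinD; apply: leeD2l; rewrite ge0_integralZl_EFin//; last 2 first.
- by move=> t /sub/P0.
- by rewrite invr_ge0 ltW.
rewrite EFinM; apply: lee_wpmul2l; first by rewrite lee_fin invr_ge0 ltW.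
rewrite fineK ?ge0_fin_numE// ME; apply: ge0_subset_integral => //.
Qed.

(** An infinite value at t would be infinite on all of (0, t), against the bound on the integral. *)
Lemma rearr_fin (f : R -> R) t : calM a phi w f -> oint 0 a t ->
  rearr a (EFin \o f) t = (fstar a f t)%:E.
Proof.
move=> /calM_integral_bound[A [B H]] It; rewrite /fstar fineK//.
rewrite ge0_fin_numE ?rearr_ge0// ltey; apply/eqP => ry.
have := H t It; rewrite leNgt => /negP; apply.
rewrite (@lt_le_trans _ _ +oo%E) ?ltry//.
have -> : (+oo = \int[mu]_(s in `]0%R, t[) (cst +oo s))%E.
  have -> : (\int[mu]_(s in `]0%R, t[) (cst +oo s) = +oo * mu (`]0%R, t[%classic : set R))%E.
    by apply: integral_cst.
  by rewrite lebesgue_measure_itv0 ?ltW ?(oint_gt0 It)// gt0_mulye// lte_fin (oint_gt0 It).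
apply: ge0_le_integral => //; [by move=> s _; exact: leey|exact: measurable_rearr|].
by move=> s; rewrite /= in_itv/= => /andP[_ /ltW st]; rewrite -ry; exact: rearr_le.
Qed.

Lemma decreasing_fstar (f : R -> R) : calM a phi w f -> decreasing_on a (fstar a f).
Proof.
move=> fM; split.
- exact: (dec_gt0 wP).
- by move=> t It; rewrite -lee_fin -(rearr_fin fM It) rearr_ge0.
- move=> s t Is It st; rewrite -lee_fin -(rearr_fin fM It) -(rearr_fin fM Is).
  exact: rearr_le.
- move=> t It; have [A [B /(_ t It)]] := calM_integral_bound fM.
  rewrite (@eq_lebesgue_integral _ _ _ (fun s => (fstar a f s)%:E)).
    by move/le_lt_trans; apply; rewrite ltry.
  by move=> s /(sub_itv_oint (oint_dom It)); exact: rearr_fin.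
Qed.

Lemma prim_fstar_bound (f : R -> R) : calM a phi w f ->
  exists A B, forall y, dom a y -> prim a (fstar a f) y <= A * prim a w y + B.
Proof.
move=> fM; have [A [B H]] := calM_integral_bound fM.
have kP := decreasing_fstar fM.
(* Nonnegative constants make the bound monotone in W, so it survives the passage to a finite end
   point a by continuity. *)
exists `|A|, `|B| => y dy; have y0 := dy.1.
have HI x : oint 0 a x -> prim a (fstar a f) x <= `|A| * prim a w x + `|B|.
  move=> Ix; have := H x Ix.
  rewrite (@eq_lebesgue_integral _ _ _ (fun s => (fstar a f s)%:E)); last first.
    by move=> s /(sub_itv_oint (oint_dom Ix)); exact: rearr_fin.
  rewrite (prim_integral kP (lexx 0) (ltW (oint_gt0 Ix)) (oint_dom Ix)) prim0 subr0 lee_fin.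
  have : 0 <= prim a w x.
    by rewrite -(prim0 a w); apply: prim_mono => //; [exact: ltW (oint_gt0 Ix)|exact: oint_dom].
  have := ler_norm A; have := ler_norm B; nra.
have W0 : 0 <= prim a w y by rewrite -(prim0 a w); apply: prim_mono.
move: y0; rewrite le_eqVlt => /predU1P[<-|y0].
  by rewrite !prim0 mulr0 add0r.
apply/ler_addgt0Pr => e e0.
have := @prim_continuous _ _ _ kP y; move/(@cvgrPdist_lt _ R^o)/(_ _ e0) => [d /= d0 Hd].
set z := Num.max (y / 2) (y - d / 2).
have zy : z < y by rewrite gt_max; apply/andP; split; lra.
have z0 : 0 < z by rewrite lt_max; apply/orP; left; lra.
have dz : y - d / 2 <= z by rewrite le_max lexx orbT.
have Iz : oint 0 a z by exact: dom_oint dy.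
have := Hd z; rewrite /ball_/= ger0_norm; last lra.
have yz : y - z < d by lra.
move=> /(_ yz); rewrite ltr_norml => /andP[_].
have := HI z Iz; have : prim a w z <= prim a w y by apply: prim_mono => //; exact: ltW.
have := normr_ge0 A; nra.
Qed.

End finiteness.

(** * Comparison of the modulars *)

Section main.
Variables (R : realType) (a : \bar R) (phi w f : R -> R) (A B : R).
Local Notation mu := (@lebesgue_measure R).
Hypothesis phi_orlicz : orlicz_function phi.
Hypothesis wP : decreasing_on a w.
Hypothesis w_gt0 : forall t, oint 0 a t -> 0 < w t.
Hypothesis fM : calM a phi w f.
Local Notation k := (fstar a f).
Local Notation F := (prim a k).
Local Notation W := (prim a w).
Hypothesis FAB : forall y, dom a y -> F y <= A * W y + B.
Local Notation slope := (slope a F W).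
Local Notation v := (optimal_weight a k w).

Let kP := decreasing_fstar phi_orlicz wP w_gt0 fM.
Let kE := fun t => @rearr_fin _ _ _ _ phi_orlicz wP w_gt0 f t fM.

Let k_rc t c : oint 0 a t -> (forall y, t < y -> oint 0 a y -> k y <= c) -> k t <= c.
Proof.
move=> It H; rewrite -lee_fin -kE//; apply: rearr_rc => // y ty Iy.
by rewrite kE// lee_fin; exact: H.
Qed.

Let PP := primitive_pair_prim kP wP w_gt0 FAB.
Let mI := @measurable_oint R 0 a.

Let slopew t := slope t * w t.

Let slopew_ge0 t : oint 0 a t -> 0 <= slopew t.
Proof. by move=> It; rewrite mulr_ge0 ?(slope_ge0 PP)// ltW// w_gt0. Qed.

Let slopew_le s t : oint 0 a s -> oint 0 a t -> s <= t -> slopew t <= slopew s.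
Proof.
move=> Is It st; apply: ler_pM; [exact: (slope_ge0 PP)|exact/ltW/w_gt0| |exact: (dec_le wP)].
exact: (slope_le PP).
Qed.

(** The value that the modulars of f^0 / l and of slope * w / l share, free of rearrangements. *)
Definition level_modular (l : R) : \bar R :=
  (\int[mu]_(t in oint 0 a) (er_map phi ((slopew t / l)%:E / (w t)%:E) * (w t)%:E))%E.

Let mslopew (D : set R) : measurable D -> D `<=` oint 0 a -> measurable_fun D slopew.
Proof.
by move=> mD DI; apply/measurable_EFinP; exact: (measurable_slope_weight kP wP w_gt0 FAB).
Qed.

Let mslopew_l l : measurable_fun (oint 0 a) (fun t => slopew t / l).
Proof. by apply: measurable_funM; [exact: mslopew|exact: measurable_cst]. Qed.

Let mw : measurable_fun (oint 0 a) w.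
Proof. exact: (measurable_weight wP). Qed.

Let er_phi_ge0 (x : \bar R) (u : R) : (0 <= x)%E -> 0 < u ->
  (0 <= er_map phi (x / u%:E) * u%:E)%E.
Proof.
move=> x0 u0; apply: mule_ge0; last by rewrite lee_fin ltW.
rewrite inver gt_eqF//; case: x x0 => [r| |]//.
  by rewrite lee_fin => r0; rewrite lee_fin (phi_ge0 phi_orlicz)// divr_ge0// ltW.
by move=> _; rewrite mulyr gtr0_sg ?invr_gt0// mul1e/= leey.
Qed.

Lemma modular_level (h : R -> \bar R) l N : 0 < l -> countable N ->
  (forall t, oint 0 a t -> ~ N t -> rearr a h t = (slopew t)%:E) ->
  modular a phi w (fun x => h x / l%:E)%E = level_modular l.
Proof.
move=> l0 cN H; apply: (ge0_eq_integral_countable mI cN).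
- apply: measurable_er_map_phi => //; first exact: measurable_rearr.
  by move=> t _; exact: rearr_ge0.
- apply: measurable_er_map_phi => //.
    by apply/measurable_EFinP; exact: mslopew_l.
  by move=> t It; rewrite lee_fin divr_ge0 ?slopew_ge0// ltW.
- by move=> t It; apply: er_phi_ge0 => //; [exact: rearr_ge0|exact: w_gt0].
- move=> t It; apply: er_phi_ge0 => //; last exact: w_gt0.
  by rewrite lee_fin divr_ge0 ?slopew_ge0// ltW.
- by move=> t It Nt; rewrite rearr_div// H// inver gt_eqF.
Qed.

Lemma modular_level_fun l : 0 < l ->
  modular a phi w (fun x => level_fun a w f x / l%:E)%E = level_modular l.
Proof.
move=> l0.
have cJ := countable_jumps kP wP w_gt0 FAB.
have LE t : oint 0 a t -> ~ jumps a k w t -> level_fun a w f t = (slopew t)%:E.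
  by move=> It nj; rewrite (level_funE kE kP wP w_gt0 k_rc FAB It nj).
have L0 t : oint 0 a t -> (0 <= level_fun a w f t)%E.
  move=> It; rewrite /level_fun; case: pselect => [ex|_]; last exact: rearr_ge0.
  case: cid => -[al b] /= [[[_ _ _ e0 _] _] _].
  by apply: mule_ge0; [exact: ltW|rewrite lee_fin ltW// w_gt0].
have [|N cN HN] := @rearr_ae_nonincreasing _ a (level_fun a w f) _ cJ L0.
  by move=> s t Is It ns nt /ltW st; rewrite !LE// lee_fin slopew_le.
apply: (modular_level l0 (countable_setU cN cJ)).
by move=> t It /not_orP[nN nj]; rewrite HN// LE.
Qed.

Lemma modular_slopew l : 0 < l ->
  modular a phi w (fun x => (EFin \o slopew) x / l%:E)%E = level_modular l.
Proof.
move=> l0; have [N cN HN] := rearr_nonincreasing slopew_ge0 slopew_le.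
exact: (modular_level l0 cN).
Qed.

Lemma slopew_L0 : L0 a slopew.
Proof.
move=> _ Y mY; have mIc : measurable (oint 0 a : set (lebesgueR R)).
  by apply: sub_caratheodory; exact: mI.
by apply: sub_caratheodory; apply: (mslopew mI) => //.
Qed.

Lemma prec_slopew : prec a (EFin \o f) (EFin \o slopew).
Proof.
move=> x Ix; rewrite (integral_rearr_nonincreasing Ix slopew_ge0 slopew_le).
rewrite (@eq_lebesgue_integral _ _ _ (fun s => (k s)%:E)); last first.
  by move=> s /(sub_itv_oint (oint_dom Ix)); exact: kE.
exact: (le_integral_level kP wP w_gt0 k_rc FAB (oint_dom Ix)).
Qed.

(* The lower bound for the P- and the Q-construction at once: [u = w] for the
   latter, [g = f] for the former. *)
Lemma level_modular_le (g : R -> \bar R) (u : R -> R) l : 0 < l -> decreasing_weight a u ->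
  prec a (EFin \o u) (EFin \o w) -> prec a (EFin \o f) g ->
  (level_modular l <= modular a phi u (fun x => g x / l%:E))%E.
Proof.
move=> l0 [ugt ule] uw fg.
have u_gt0 t : oint 0 a t -> 0 < u t by move=> It; apply: ugt; rewrite inE.
have u_le s t : oint 0 a s -> oint 0 a t -> s <= t -> u t <= u s.
  by move=> Is It st; apply: ule => //; rewrite inE.
have int_u x : oint 0 a x -> (\int[mu]_(t in `]0%R, x[) (u t)%:E <= (W x)%:E)%E.
  move=> Ix; rewrite -(integral_rearr_nonincreasing Ix _ u_le); last by move=> t /u_gt0/ltW.
  apply: le_trans (uw x Ix) _; rewrite (integral_rearr_nonincreasing Ix).
  - by rewrite (prim_integral wP (lexx 0) (ltW (oint_gt0 Ix)) (oint_dom Ix)) prim0 subr0.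
  - by move=> t /w_gt0/ltW.
  - exact: (dec_le wP).
have mu_u : measurable_fun (oint 0 a) u.
  apply/measurable_EFinP; apply: nonincreasing_in_measurable; first exact: is_interval_oint.
  by move=> s t Is It st; rewrite lee_fin u_le.
have mg D : measurable D -> measurable_fun D (rearr a g) by exact: measurable_rearr.
rewrite /modular (@eq_lebesgue_integral _ _ _
  (fun t => er_map phi ((rearr a g t / l%:E) / (u t)%:E) * (u t)%:E)%E); last first.
  by move=> t _; rewrite rearr_div.
have mgl : measurable_fun (oint 0 a) (fun t => rearr a g t / l%:E)%E.
  by apply: emeasurable_funM; [exact: mg|exact: measurable_cst].
(* Dividing by l moves the hinge from s to l * s. *)
have maxZ (x : \bar R) (y s : R) : (x \is a fin_num) || (x == +oo%E) ->
    (maxe (x / l%:E - (s * y)%:E) 0 = (l^-1)%:E * maxe (x - (l * s * y)%:E) 0)%E.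
  rewrite inver (gt_eqF l0); case: x => [r| |]// _.
    rewrite -EFinM -!EFinB -!EFin_max -EFinM; congr EFin.
    rewrite maxr_pMr ?invr_ge0 ?(ltW l0)// mulr0; congr Num.max.
    by field; rewrite gt_eqF.
  rewrite mulyr gtr0_sg ?invr_gt0// mul1e !addye//.
  have -> : (maxe +oo 0 = +oo :> \bar R)%E by apply/max_idPl; exact: leey.
  by rewrite gt0_muley ?lte_fin ?invr_gt0.
apply: orlicz_integral_le => //.
- by move=> t It; rewrite divr_ge0 ?slopew_ge0// ltW.
- move=> t _; rewrite inver gt_eqF//; apply: mule_ge0; first exact: rearr_ge0.
  by rewrite lee_fin invr_ge0 ltW.
move=> s s0; have ls0 : 0 < l * s by rewrite mulr_gt0.
rewrite (@eq_lebesgue_integral _ _ _ (fun t => (l^-1)%:E *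
    maxe ((slopew t)%:E - (l * s * w t)%:E) 0)%E); last first.
  by move=> t _; rewrite -maxZ// inver gt_eqF.
rewrite [leRHS](@eq_lebesgue_integral _ _ _ (fun t => (l^-1)%:E *
    maxe (rearr a g t - (l * s * u t)%:E) 0)%E); last first.
  move=> t _; rewrite maxZ//; have := rearr_ge0 a g t.
  by case: (rearr a g t).
have lge0 : 0 <= l^-1 by rewrite invr_ge0 ltW.
have max0 (x : \bar R) : (0 <= maxe x 0)%E by rewrite le_max lexx orbT.
rewrite ge0_integralZl_EFin//; last first.
  by apply: measurable_excess_part => //; apply/measurable_EFinP; exact: mslopew.
rewrite ge0_integralZl_EFin//; last by apply: measurable_excess_part => //; exact: mg.
apply: lee_wpmul2l => //.
apply: (slope_excess_integral kP wP w_gt0 k_rc FAB) => //; first exact: integral_ge0.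
move=> y Iy; have sub := sub_itv_oint (oint_dom Iy).
have mge J : measurable J -> J `<=` oint 0 a ->
    measurable_fun J (fun t => maxe (rearr a g t - (l * s * u t)%:E) 0)%E.
  move=> mJ JI; apply: measurable_excess_part; first exact: mg.
  exact: measurable_funS mu_u.
apply: (@le_trans _ _ (\int[mu]_(t in `]0%R, y[)
    maxe (rearr a g t - (l * s * u t)%:E) 0)%E); last first.
  by apply: ge0_subset_integral => //; exact: mge.
have mux : measurable_fun `]0, y[ (fun t => (l * s)%:E * (u t)%:E)%E.
  apply: emeasurable_funM; first exact: measurable_cst.
  by apply/measurable_EFinP; exact: measurable_funS mu_u.
(* The bound is kept additive until the end, because the integral of the rearrangement of g may be
   infinite. *)
have h1 : ((F y)%:E <= \int[mu]_(t in `]0%R, y[) (maxe (rearr a g t - (l * s * u t)%:E) 0 +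
    (l * s)%:E * (u t)%:E))%E.
  have -> : (F y)%:E = (\int[mu]_(t in `]0%R, y[) rearr a (EFin \o f) t)%E.
    rewrite (@eq_lebesgue_integral _ _ _ (fun s => (k s)%:E)); last by move=> t /sub; exact: kE.
    by rewrite (prim_integral kP (lexx 0) (ltW (oint_gt0 Iy)) (oint_dom Iy)) prim0 subr0.
  apply: le_trans (fg y Iy) _; apply: ge0_le_integral => //.
  - by move=> t _; exact: rearr_ge0.
  - exact: mg.
  - by apply: emeasurable_funD => //; exact: mge.
  - by move=> t _; rewrite -EFinM -leeBlDr// le_max lexx.
move: h1; rewrite ge0_integralD//; last 2 first.
- exact: mge.
- by move=> t /sub/u_gt0 ut; rewrite -EFinM lee_fin mulr_ge0// ltW.
rewrite ge0_integralZl_EFin//; last 3 first.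
- by move=> t /sub/u_gt0/ltW; rewrite lee_fin.
- by apply/measurable_EFinP; exact: measurable_funS mu_u.
- exact: ltW.
move=> h1; rewrite /excess EFinB leeBlDr//; apply: le_trans h1 _; apply: leeD2l.
by rewrite [leRHS]EFinM; apply: lee_wpmul2l; [rewrite lee_fin ltW|exact: int_u].
Qed.

Lemma optimal_weight_decreasing : decreasing_weight a v.
Proof.
split=> [t|s t]; rewrite !inE.
  exact: (optimal_weight_gt0 kP wP w_gt0 FAB).
by move=> Is It; exact: (optimal_weight_le kP wP w_gt0 FAB).
Qed.

Let v_ge0 t : oint 0 a t -> 0 <= v t.
Proof. by move=> It; apply/ltW/(optimal_weight_gt0 kP wP w_gt0 FAB). Qed.

Lemma prec_optimal_weight : prec a (EFin \o v) (EFin \o w).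
Proof.
move=> x Ix; rewrite (integral_rearr_nonincreasing Ix v_ge0); last first.
  exact: (optimal_weight_le kP wP w_gt0 FAB).
rewrite (integral_rearr_nonincreasing Ix (dec_ge0 wP) (dec_le wP)).
have E (u : R -> R) : (\int[mu]_(t in `]0%R, x[) (cst 1 (slope t) * u t)%:E =
    \int[mu]_(t in `]0%R, x[) (u t)%:E)%E.
  by apply: eq_lebesgue_integral => t _; rewrite mul1r.
have := le_integral_optimal (h := cst 1) kP wP w_gt0 FAB (oint_dom Ix) (measurable_cst _)
  (fun _ _ => ler01).
by rewrite !E.
Qed.

(** Off the jumps the quotient of f^* by v is the slope, so both modulars integrate the same
    function of the slope, against v and against w. *)
Lemma modular_optimal_weight l : 0 < l ->
  (modular a phi v (fun x => (EFin \o f) x / l%:E) <= level_modular l)%E.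
Proof.
move=> l0; have mv : measurable_fun (oint 0 a) v.
  exact: (measurable_optimal_weight kP wP w_gt0 FAB).
have v_gt0 t : oint 0 a t -> 0 < v t by exact: (optimal_weight_gt0 kP wP w_gt0 FAB).
pose h c := phi (Num.max (c / l) 0).
have hE t : oint 0 a t -> h (slope t) = phi (slope t / l).
  move=> It; rewrite /h; congr phi; apply/max_idPl; rewrite divr_ge0 ?(slope_ge0 PP)//.
  exact: ltW.
have h0 t : oint 0 a t -> 0 <= h (slope t).
  by move=> It; rewrite /h (phi_ge0 phi_orlicz)// le_max lexx orbT.
have mh : measurable_fun (oint 0 a) (h \o slope).
  apply: (measurableT_comp (f := h)).
    apply: nondecreasing_measurable => // x y xy; apply: (phi_mono phi_orlicz).
      by rewrite le_max lexx orbT.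
    rewrite ge_max !le_max lexx orbT andbT; apply/orP; left.
    by rewrite ler_pM2r ?invr_gt0.
  exact: (measurable_slope kP wP w_gt0 FAB).
have mhv : measurable_fun (oint 0 a) (fun t => (h (slope t) * v t)%:E).
  by apply/measurable_EFinP; exact: measurable_funM mh mv.
have mhw : measurable_fun (oint 0 a) (fun t => (h (slope t) * w t)%:E).
  by apply/measurable_EFinP; exact: measurable_funM mh mw.
have -> : level_modular l = (\int[mu]_(t in oint 0 a) (h (slope t) * w t)%:E)%E.
  apply: eq_lebesgue_integral => t It; rewrite hE// inver gt_eqF ?w_gt0//= -EFinM.
  by congr (phi _ * _)%:E; rewrite /slopew; field; rewrite !gt_eqF ?w_gt0.
have -> : modular a phi v (fun x => (EFin \o f) x / l%:E)%E =
    (\int[mu]_(t in oint 0 a) (h (slope t) * v t)%:E)%E.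
  apply: (ge0_eq_integral_countable mI (countable_jumps kP wP w_gt0 FAB)) => //.
  - apply: measurable_er_map_phi => //; first exact: measurable_rearr.
    by move=> t _; exact: rearr_ge0.
  - by move=> t It; apply: er_phi_ge0 => //; [exact: rearr_ge0|exact: v_gt0].
  - by move=> t It; rewrite lee_fin mulr_ge0 ?h0// v_ge0.
  - move=> t It nj; rewrite rearr_div// kE// hE// !inver !gt_eqF ?v_gt0//= -EFinM.
    congr (phi _ * _)%:E; rewrite (slope_optimal_weight kP wP w_gt0 k_rc FAB It nj).
    by field; rewrite !gt_eqF ?v_gt0.
apply: integral_oint_sup => //.
- exact: (dec_gt0 wP).
- by move=> t It; rewrite lee_fin mulr_ge0 ?h0// v_ge0.
move=> x Ix; apply: le_trans (le_integral_optimal kP wP w_gt0 FAB (oint_dom Ix) mh h0) _.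
apply: ge0_subset_integral => //; last exact: (sub_itv_oint (oint_dom Ix)).
by move=> t It; rewrite lee_fin mulr_ge0 ?h0// ltW// w_gt0.
Qed.

(** The weight v and the function slope * w are independent of l, so each infimum is attained and
    one comparison per l settles both gauges. *)
Lemma gauge_level (gauge : ((R -> \bar R) -> \bar R) -> (R -> \bar R) -> \bar R) :
  monotone_gauge gauge ->
  ereal_inf [set gauge (modular a phi v) (EFin \o f) | v in
    [set v : R -> R | decreasing_weight a v /\ prec a (EFin \o v) (EFin \o w)]] =
      gauge (modular a phi w) (level_fun a w f) /\
  ereal_inf [set gauge (modular a phi w) (EFin \o g) | g in
    [set g : R -> R | L0 a g /\ prec a (EFin \o f) (EFin \o g)]] =
      gauge (modular a phi w) (level_fun a w f).
Proof.
move=> mono; have ww : decreasing_weight a w.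
  split=> [t|s t]; rewrite !inE; first exact: w_gt0.
  by move=> Is It; exact: (dec_le wP).
split; apply/eqP; rewrite eq_le; apply/andP; split.
- apply: (@le_trans _ _ (gauge (modular a phi v) (EFin \o f))).
    apply: ereal_inf_lbound; exists v => //.
    by split; [exact: optimal_weight_decreasing|exact: prec_optimal_weight].
  by apply: mono => l l0; rewrite modular_level_fun//; exact: modular_optimal_weight.
- apply: le_ereal_inf_tmp => _ [u [du uw] <-]; apply: mono => l l0.
  rewrite (modular_level_fun l0).
  exact: (level_modular_le l0 du uw (fun _ _ => lexx _)).
- apply: (@le_trans _ _ (gauge (modular a phi w) (EFin \o slopew))).
    apply: ereal_inf_lbound; exists slopew => //.
    by split; [exact: slopew_L0|exact: prec_slopew].
  by apply: mono => l l0; rewrite modular_level_fun// modular_slopew.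
- apply: le_ereal_inf_tmp => _ [g [_ fg] <-]; apply: mono => l l0.
  rewrite (modular_level_fun l0).
  exact: (level_modular_le l0 ww (fun _ _ => lexx _) fg).
Qed.

End main.

Theorem theorem8p8 (R : realType) (a : \bar R) (phi w : R -> R)
  (a_gt0 : (0 < a)%E)
  (phi_orlicz : orlicz_function phi)
  (w_weight : decreasing_weight a w)
  (W_fin : forall t : R, oint 0 a t ->
     (\int[lebesgue_measure]_(s in `]0%R, t[) (w s)%:E < +oo)%E)
  (f : R -> R) (fM : calM a phi w f) :
  [/\ calM_norm a phi w f =
        ereal_inf [set luxemburg (modular a phi v) (EFin \o f) | v in
          [set v : R -> R | decreasing_weight a v /\
                            prec a (EFin \o v) (EFin \o w)]],
      ereal_inf [set luxemburg (modular a phi v) (EFin \o f) | v in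
          [set v : R -> R | decreasing_weight a v /\
                            prec a (EFin \o v) (EFin \o w)]] =
        ereal_inf [set luxemburg (modular a phi w) (EFin \o g) | g in
          [set g : R -> R | L0 a g /\ prec a (EFin \o f) (EFin \o g)]] &
      ereal_inf [set luxemburg (modular a phi w) (EFin \o g) | g in
          [set g : R -> R | L0 a g /\ prec a (EFin \o f) (EFin \o g)]] =
        luxemburg (modular a phi w) (level_fun a w f)]
  /\
  [/\ calM_norm0 a phi w f =
        ereal_inf [set amemiya (modular a phi v) (EFin \o f) | v in
          [set v : R -> R | decreasing_weight a v /\
                            prec a (EFin \o v) (EFin \o w)]],
      ereal_inf [set amemiya (modular a phi v) (EFin \o f) | v in
          [set v : R -> R | decreasing_weight a v /\
                            prec a (EFin \o v) (EFin \o w)]] =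
        ereal_inf [set amemiya (modular a phi w) (EFin \o g) | g in
          [set g : R -> R | L0 a g /\ prec a (EFin \o f) (EFin \o g)]] &
      ereal_inf [set amemiya (modular a phi w) (EFin \o g) | g in
          [set g : R -> R | L0 a g /\ prec a (EFin \o f) (EFin \o g)]] =
        amemiya (modular a phi w) (level_fun a w f)].
Proof.
have w_gt0 t : oint 0 a t -> 0 < w t by move=> It; apply: w_weight.1; rewrite inE.
have wP := decreasing_weight_on a_gt0 w_weight W_fin.
have [A [B FAB]] := prim_fstar_bound phi_orlicz wP w_gt0 fM.
have [P1 Q1] := gauge_level phi_orlicz wP w_gt0 fM FAB (@luxemburg_monotone R).
have [P2 Q2] := gauge_level phi_orlicz wP w_gt0 fM FAB (@amemiya_monotone R).
split; split.
- exact: (etrans Q1 (esym P1)).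
- exact: (etrans P1 (esym Q1)).
- exact: Q1.
- exact: (etrans Q2 (esym P2)).
- exact: (etrans P2 (esym Q2)).
- exact: Q2.
Qed.
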